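(* Let $n,k,r,s$ be positive integers and let $\mathcal{H}$ be an $r$-graph on $n$ vertices with $\nu(\mathcal{H})\leq k$. \begin{itemize} \item[(I)] If $r\leq s\leq k+r-1$ and $n\geq 4(er)^{s-r+2}k$, then $K_s^r(\mathcal{H})\leq K_s^r(\mathcal{F}^{(r)}_{n,k,1})$. \item[(II)] If $k+r\leq s\leq (r-1)(k+1)$ and $n\geq 4r^2k\,(er/(a-1))^{s-r+a}$, where $a=\lfloor \frac{s-r}{k}\rfloor+1$, then $K_s^r(\mathcal{H})\leq K_s^r(\mathcal{F}^{(r)}_{n,k,a})$. \item[(III)] If $(r-1)k+r\leq s\leq rk+r-1$ and $n\geq rk+r-1$, then $K_s^r(\mathcal{H})\leq K_s^r(\mathcal{F}^{(r)}_{n,k,r})$. Moreover, if $K_s^r(\mathcal{H})< K_s^r(\mathcal{F}^{(r)}_{n,k,r})$, then $K_s^r(\mathcal{H})\leq \binom{rk+r-1}{s}-\binom{rk-1}{s-r}$. \end{itemize}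
   Context: An $r$-graph $\mathcal{H}$ is a pair $(V,E)$ with $V$ a finite set and $E\subseteq\binom{V}{r}$; edges are identified with $\mathcal{H}$. For $s\geq r$, an $s$-clique of $\mathcal{H}$ is a set of $s$ vertices every $r$-subset of which is an edge of $\mathcal{H}$; $K_s^r(\mathcal{H})$ denotes the number of $s$-cliques of $\mathcal{H}$. A matching is a set of pairwise disjoint edges; $\nu(\mathcal{H})$ is the maximum size of a matching. $[m]=\{1,\dots,m\}$. For positive integers $n,k,r,a$ with $n\geq r\geq a$, $\mathcal{F}^{(r)}_{n,k,a}$ is the $r$-graph on vertex set $[n]$ with edge set $\{F\in\binom{[n]}{r}: |F\cap[ak+a-1]|\geq a\}$. Here $e$ is Euler's number. *)

(* Defs.v *)
From HB Require Import structures.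
From mathcomp Require Import all_boot.

Set Implicit Arguments.
Unset Strict Implicit.
Unset Printing Implicit Defensive.

(* A hypergraph is given by its edge set over a finite vertex type. *)
Definition is_rgraph (r : nat) (V : finType) (H : {set {set V}}) : Prop :=
  forall e : {set V}, e \in H -> #|e| = r.

Definition is_clique (r s : nat) (V : finType) (H : {set {set V}})
    (S : {set V}) : bool :=
  (#|S| == s) &&
  [forall e : {set V}, (e \subset S) && (#|e| == r) ==> (e \in H)].

Definition num_cliques (r s : nat) (V : finType) (H : {set {set V}}) : nat :=
  #|[set S : {set V} | is_clique r s H S]|.

Definition is_matching (V : finType) (H M : {set {set V}}) : bool :=
  (M \subset H) && trivIset M.

Definition matching_number (V : finType) (H : {set {set V}}) : nat :=
  \max_(M : {set {set V}} | is_matching H M) #|M|.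

(* The vertex set [n] is 'I_n, indexed from 0, so that the initial segment
   [m] consists of the i : 'I_n with i < m. *)
Definition frankl (n k r a : nat) : {set {set 'I_n}} :=
  [set F : {set 'I_n} |
    (#|F| == r) &&
    (a <= #|F :&: [set i : 'I_n | i < a * k + a - 1]|)].

(* Main.v *)
Require Import Defs.
From mathcomp Require Import all_boot all_order all_algebra perm.
From mathcomp Require Import reals sequences exp.
From mathcomp Require Import zify ring lra.

Set Implicit Arguments.
Unset Strict Implicit.
Unset Printing Implicit Defensive.

(** Part (III): among maximum matchings [M] and pairs of [s]-cliques [S], [T]
    with [T] not covered by [S] and [M], maximise first the number of vertices
    of [S] outside [M], then that of [T].  Exchange arguments show that edges
    of [M] inside one clique avoid the other, and counting missed vertices is
    contradictory; hence all [s]-cliques live on [r k + r - 1] vertices.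

    Parts (I) and (II): shifting does not decrease the number of [s]-cliques and
    creates no larger matching, so [H] may be assumed shifted.  Let
    [m = a (k + 1) - 1] and [j = s - r + a].  The first [j] vertices [T] of a
    clique lie in a short initial segment; if they are not all among the first
    [m] vertices, the sets completing [T] to a clique have no matching of size
    [k + 1], so by averaging over permutations there are few of them.  If such a
    clique exists at all, then many [s]-sets which are cliques of the extremal
    graph are not cliques of [H], and for large [n] this loss dominates. *)

(** * Matchings and shifting *)

(** For large n, let Z be the family of s-sets with at least j vertices among the first m, all
    cliques of the extremal graph. The gain of H over Z is a sum over initial parts T, each with at
    most (2 k q / n) C(n, q) completions, where q = r - a. In part (II) the number of T is at most
    C(r k + r - 1, j), and j >= (a - 1) (k + 1) turns this into (e r / (a - 1))^j; a single block
    whose completions are mostly lost outweighs it. For a = 1 that bound breaks down: j may stay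
    small while k grows, the number of T is of order k^j, and n is only linear in k. So part (I)
    measures how far H is from the extremal graph by the largest u <= k for which the edges avoiding
    the first u vertices have no matching of size k - u + 1. Cliques with j vertices among the first
    u are common to both sides, and the comparison is between C(u + r (k - u) + 1, j) - C(u, j) and
    C(k, j) - C(u, j), whose ratio is at most 2 (e r)^j whatever u is. *)

Definition has_matching (V : finType) (L : {set {set V}}) (t : nat) : Prop :=
  exists A : 'I_t -> {set V},
    (forall i, A i \in L) /\ (forall i i', i != i' -> [disjoint A i & A i']).

(** Index types such as [option] and sums let a matching be extended by one edge or joined with
    another. *)
Lemma has_matching_fin (V I : finType) (L : {set {set V}}) (A : I -> {set V}) t :
  t <= #|I| -> (forall i, A i \in L) ->
  (forall i i', i != i' -> [disjoint A i & A i']) -> has_matching L t.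
Proof.
move=> tI AL Adis; exists (fun i => A (enum_val (widen_ord tI i))); split=> // i i' ii'.
by apply: Adis; apply: contra_neq ii' => /enum_val_inj /(congr1 val) /= /val_inj.
Qed.

Lemma has_matching_leq (V : finType) (L : {set {set V}}) t t' :
  t' <= t -> has_matching L t -> has_matching L t'.
Proof.
by move=> tt' [A [AL Ad]]; apply: (has_matching_fin (A := A)) => //; rewrite card_ord.
Qed.

Lemma has_matching_sub (V : finType) (L L' : {set {set V}}) t :
  L \subset L' -> has_matching L t -> has_matching L' t.
Proof. by move=> /subsetP LL' [A [AL Ad]]; exists A; split=> // i; apply: LL'. Qed.

(** For positive r the edges are nonempty, so a disjoint indexed family is injective. *)
Lemma has_matching_number (V : finType) (H : {set {set V}}) r t :
  0 < r -> is_rgraph r H -> has_matching H t -> t <= matching_number H.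
Proof.
move=> r0 Hr [A [AH Ad]].
have injA : injective A.
  move=> i i' eqA; apply/eqP/negPn/negP => /Ad; rewrite eqA -setI_eq0 setIid.
  by move/eqP=> A0; have := Hr _ (AH i'); rewrite A0 cards0; lia.
rewrite -[t]card_ord -cardsT -(card_imset _ injA) /matching_number.
apply: (bigmax_sup (A @: setT)) => //; apply/andP; split.
  by apply/subsetP => _ /imsetP[i _ ->].
apply/trivIsetP => _ _ /imsetP[i _ ->] /imsetP[i' _ ->] neA.
by apply: Ad; apply: contra_neq neA => ->.
Qed.

Section Shift.
Variables (n : nat) (x y : 'I_n).
Implicit Types (G : {set {set 'I_n}}) (e : {set 'I_n}).

Definition swap e : {set 'I_n} := x |: (e :\ y).

(** A set stays put when its image is already present; this is what makes the map injective on G. *)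
Definition shift_set G e : {set 'I_n} :=
  if [&& y \in e, x \notin e & swap e \notin G] then swap e else e.

Definition shift G := shift_set G @: G.

Lemma swapK e : y \in e -> x \notin e -> y |: (swap e :\ x) = e.
Proof.
move=> ye xe; apply/setP => z; rewrite !inE.
case: (eqVneq z y) => [->|zy] //=; case: (eqVneq z x) => [->|zx] //=.
by rewrite (negPf xe).
Qed.

Lemma card_swap e : y \in e -> x \notin e -> #|swap e| = #|e|.
Proof.
move=> ye xe; rewrite cardsU1 !inE (negPf xe) andbF /=.
by rewrite (cardsD1 y e) ye.
Qed.

Lemma shift_set_inj G : {in G &, injective (shift_set G)}.
Proof.
move=> e f eG fG; rewrite /shift_set.
case: ifP => [/and3P[ye xe eG']|_]; case: ifP => [/and3P[yf xf fG']|_] //.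
- by move=> eqs; rewrite -(swapK ye xe) eqs swapK.
- by move=> eqs; rewrite eqs fG in eG'.
- by move=> eqs; rewrite -eqs eG in fG'.
Qed.

Lemma card_shift G : #|shift G| = #|G|.
Proof. by rewrite card_in_imset //; apply: shift_set_inj. Qed.

Lemma shift_set_card G e : #|shift_set G e| = #|e|.
Proof. by rewrite /shift_set; case: ifP => // /and3P[? ? _]; apply: card_swap. Qed.

Lemma shift_rgraph r G : is_rgraph r G -> is_rgraph r (shift G).
Proof. by move=> Gr _ /imsetP[e eG ->]; rewrite shift_set_card Gr. Qed.

Lemma shift_fixed G e : e \in G ->
  (y \in e -> x \notin e -> swap e \in G) -> e \in shift G.
Proof.
move=> eG h; apply/imsetP; exists e => //; rewrite /shift_set.
by case: ifP => // /and3P[ye xe]; rewrite h.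
Qed.

Lemma shift_swap G e : e \in G -> y \in e -> x \notin e -> swap e \in shift G.
Proof.
move=> eG ye xe; have [sG|sG] := boolP (swap e \in G).
  by apply: shift_fixed => // _; rewrite !inE eqxx.
by apply/imsetP; exists e => //; rewrite /shift_set ye xe sG.
Qed.

(** Moved sets contain x. A set without x was therefore left in place, and if it contains y, only
    because its swap was already in G. *)
Lemma shift_notin G e : x \notin e -> e \in shift G ->
  e \in G /\ (y \in e -> swap e \in G).
Proof.
move=> xe /imsetP[f fG]; rewrite /shift_set.
case: ifP => [_ ef|nf ef]; first by rewrite ef !inE eqxx in xe.
rewrite -{}ef in fG nf; split=> // ye.
by apply: contraFT nf => ->; rewrite ye xe.
Qed.

(** The family K of cliques is shifted by the same operator: injectivity preserves its size, and
    every shifted clique is a clique of the shifted graph. *)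
Lemma shift_cliques r s H :
  num_cliques r s H <= num_cliques r s (shift H).
Proof.
set K := [set S | is_clique r s H S].
rewrite /num_cliques -/K -(card_shift K); apply: subset_leq_card.
apply/subsetP => _ /imsetP[S SK ->].
have /andP[/eqP cS /forallP clS] : is_clique r s H S by rewrite inE in SK.
have inH e : e \subset S -> #|e| = r -> e \in H.
  by move=> eS ce; have /implyP := clS e; apply; rewrite eS ce eqxx.
rewrite inE /is_clique shift_set_card cS eqxx /=.
apply/forallP => e; apply/implyP => /andP[] ; rewrite /shift_set.
case: ifP => [/and3P[yS xS sK] eS /eqP ce|nS eS /eqP ce].
  have [xe|xe] := boolP (x \in e).
    have ye : x == y = false by apply/eqP => xy; rewrite xy yS in xS.
    have ye' : y \notin e.
      by apply/negP => /(subsetP eS); rewrite !inE eqxx eq_sym ye.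
    set f := y |: (e :\ x).
    have cf : #|f| = r.
      by rewrite cardsU1 !inE (negPf ye') andbF -ce (cardsD1 x e) xe.
    have fS : f \subset S.
      apply/subsetP => z; rewrite !inE => /orP[/eqP->//|/andP[zx ze]].
      by have := subsetP eS _ ze; rewrite !inE (negPf zx) => /andP[].
    have -> : e = swap f.
      apply/setP => z; rewrite !inE; case: (eqVneq z x) => [->|zx] //=.
      by case: (eqVneq z y) => [->|zy] //=; rewrite (negPf ye').
    by apply: shift_swap; rewrite ?inH // !inE ?eqxx ?ye.
  have ye : y \notin e.
    apply/negP => ye; have := subsetP eS _ ye; rewrite !inE eqxx /= orbF => /eqP yx.
    by rewrite -yx ye in xe.
  apply: shift_fixed; last by rewrite (negPf ye).
  apply: inH => //; apply/subsetP => z ze; have := subsetP eS _ ze.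
  by rewrite !inE => /orP[/eqP zx|/andP[]//]; rewrite -zx ze in xe.
apply: shift_fixed; first exact: inH.
move=> ye xe; have yS := subsetP eS _ ye.
have [xS|xS] := boolP (x \in S).
  apply: inH; last by rewrite card_swap.
  apply/subsetP => z; rewrite !inE => /orP[/eqP->//|/andP[_]]; exact: (subsetP eS).
(* S was not moved although it contains y and not x, so its swap is itself a clique, and it contains
   [swap e]. *)
move: nS; rewrite yS xS /= => /negbFE; rewrite inE => /andP[_ /forallP cl'].
have /implyP := cl' (swap e); apply; rewrite card_swap // ce eqxx andbT.
apply/subsetP => z; rewrite !inE; case: eqVneq => //= _ /andP[-> /=].
exact: (subsetP eS).
Qed.

(** At most one A i contains x, and all others already lie in H. If A i is the swap of some e in H,
    put e back. A member A i' containing y then meets e; it is replaced by its own swap, which is in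
    H because A i' was not moved. *)
Lemma shift_matching H t : has_matching (shift H) t -> has_matching H t.
Proof.
case=> A [AH Ad].
have [/existsP[i xi]|] := boolP [exists i, x \in A i]; last first.
  rewrite negb_exists => /forallP nx; exists A; split=> // i; have xi := nx i.
  by have [] := shift_notin xi (AH i).
have xo i' : i' != i -> x \notin A i'.
  by move=> ne; apply/negP => xi'; have := disjointFr (Ad _ _ ne) xi'; rewrite xi.
have AHo i' : i' != i -> A i' \in H.
  by move=> ne; have [] := shift_notin (xo _ ne) (AH i').
have [AiH|AiH] := boolP (A i \in H).
  by exists A; split=> // i'; case: (eqVneq i' i) => [->|/AHo].
have /imsetP[e eH] := AH i.
rewrite /shift_set; case: ifP => [/and3P[ye xe _] Ae|_ Ae]; last first.
  by rewrite Ae eH in AiH.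
have xy : x != y by apply/eqP => xy; rewrite xy ye in xe.
have [/existsP[i' yi']|] := boolP [exists i', y \in A i']; last first.
  rewrite negb_exists => /forallP ny.
  exists (fun l => if l == i then e else A l); split=> [l|l l' ll'].
    by case: (eqVneq l i) => [//|li]; apply: AHo.
  have dise l0 : l0 != i -> [disjoint e & A l0].
    move=> h; apply/pred0P => z /=; apply/negbTE/negP => /andP[ze zl].
    have zy : z != y by apply: contraTneq zl => ->; apply: ny.
    have := disjointFr (Ad _ _ h) zl; rewrite Ae !inE ze zy orbT //.
  case: (eqVneq l i) ll' => [->|li]; case: (eqVneq l' i) => [_|l'i] //.
  - by move=> _; apply: dise.
  - by move=> _; rewrite disjoint_sym; apply: dise.
  - by apply: Ad.
have ne : i' != i.
  by apply/eqP => ii'; move: yi'; rewrite ii' Ae !inE eqxx eq_sym (negPf xy).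
have [Ai'H /(_ yi') si'] := shift_notin (xo _ ne) (AH i').
exists (fun l => if l == i then e else if l == i' then swap (A i') else A l).
split=> [l|l l'].
  by case: (eqVneq l i) => [//|li]; case: (eqVneq l i') => // _; apply: AHo.
(* Disjointness is symmetric: it suffices to treat pairs listed with i first, then i', then the
   other indices. *)
wlog: l l' / (l == i) || (l' != i) && ((l == i') || (l' != i')).
  move=> wl ll'; have [c|] := boolP ((l == i) || (l' != i) && ((l == i') || (l' != i'))).
    exact: wl.
  move=> c; rewrite disjoint_sym; apply: wl; last by rewrite eq_sym.
  by move: c; case: eqP; case: eqP; case: eqP; case: eqP.
have noty l0 : l0 != i' -> y \notin A l0.
  by move=> h; apply/negP => yl; have := disjointFr (Ad _ _ h) yl; rewrite yi'.
have dise l0 : l0 != i -> l0 != i' -> [disjoint e & A l0].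
  move=> h h'; apply/pred0P => z /=; apply/negbTE/negP => /andP[ze zl].
  have zy : z != y by apply: contraTneq zl => ->; apply: noty.
  have := disjointFr (Ad _ _ h) zl; rewrite Ae !inE ze zy orbT //.
have dise' : [disjoint e & swap (A i')].
  apply/pred0P => z /=; apply/negbTE/negP; rewrite !inE => /andP[ze].
  case/orP=> [/eqP zx|/andP[zy zi']]; first by rewrite -zx ze in xe.
  by have := disjointFr (Ad _ _ ne) zi'; rewrite Ae !inE ze zy orbT.
case: (eqVneq l i) => [->|li] /=.
  move=> _ l'i; rewrite eq_sym (negPf l'i).
  by case: (eqVneq l' i') => // l'i'; apply: dise; rewrite // eq_sym.
case/andP=> l'i; rewrite (negPf l'i).
case: (eqVneq l i') => [-> _|li' /= l'i' ll'].
  rewrite eq_sym => h; rewrite (negPf h).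
  apply/pred0P => z /=; apply/negbTE/negP; rewrite !inE => /andP[/orP[/eqP->|/andP[_ z1]] z2].
    by move: (xo _ l'i); rewrite z2.
  by have := disjointFr (Ad _ _ h) z2; rewrite z1.
by rewrite (negPf l'i'); apply: Ad.
Qed.

(** Termination measure: a shift towards a smaller vertex lowers it whenever the graph changes. *)
Definition weight G := \sum_(e in G) \sum_(i in e) (i : nat).

Lemma shift_weight G : x < y -> shift G != G -> weight (shift G) < weight G.
Proof.
move=> xy neG.
have wsw e : y \in e -> x \notin e ->
    \sum_(i in swap e) (i : nat) < \sum_(i in e) (i : nat).
  move=> ye xe; rewrite (big_setD1 y ye) big_setU1 /= ?ltn_add2r //.
  by rewrite !inE (negPf xe) andbF.
rewrite /weight big_imset; last exact: shift_set_inj.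
have le e : e \in G -> \sum_(i in shift_set G e) (i : nat) <= \sum_(i in e) (i : nat).
  by move=> _; rewrite /shift_set; case: ifP => // /and3P[? ? _]; apply/ltnW/wsw.
have /exists_inP[e eG /and3P[ye xe se]] :
   [exists e in G, [&& y \in e, x \notin e & swap e \notin G]].
  apply: contraNT neG; rewrite negb_exists_in => /forall_inP h.
  rewrite /shift; apply/eqP; rewrite -[RHS]imset_id; apply: eq_in_imset => e eG.
  by rewrite /shift_set (negPf (h e eG)).
rewrite (big_setD1 e eG) [ltnRHS](big_setD1 e eG) /= -addSn leq_add //.
  by rewrite /shift_set ye xe se wsw.
by apply: leq_sum => f; rewrite inE => /andP[_]; apply: le.
Qed.

End Shift.

Definition shifted n (G : {set {set 'I_n}}) : Prop :=
  forall (x y : 'I_n) e, x < y -> e \in G -> y \in e -> x \notin e ->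
    x |: (e :\ y) \in G.

Lemma exists_shifted n r s k (H : {set {set 'I_n}}) :
  is_rgraph r H -> ~ has_matching H k ->
  exists H' : {set {set 'I_n}}, [/\ is_rgraph r H', ~ has_matching H' k,
    num_cliques r s H <= num_cliques r s H' & shifted H'].
Proof.
have [m] := ubnP (weight H); elim: m => // m IHm in H * => Hm Hr Hk.
have [/forallP sh|] :=
  boolP [forall x : 'I_n, forall y : 'I_n, (x < y) ==> (shift x y H == H)].
  exists H; split=> // x y e xy eH ye xe.
  have /forallP/(_ y)/implyP/(_ xy)/eqP <- := sh x; exact: shift_swap.
rewrite negb_forall => /existsP[x]; rewrite negb_forall => /existsP[y].
rewrite negb_imply => /andP[xy neH].
have [] := IHm (shift x y H).
- by have := shift_weight xy neH; lia.
- exact: shift_rgraph.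
- by move/shift_matching.
by move=> H' [? ? le ?]; exists H'; split=> //; apply: leq_trans le; apply: shift_cliques.
Qed.

(** * Initial segments and averaging *)

Definition ini n c : {set 'I_n} := [set i : 'I_n | i < c].
Definition itv n c d : {set 'I_n} := [set i : 'I_n | c <= i < d].
Arguments ini {n}.
Arguments itv {n}.

Lemma card_itv n c d : d <= n -> #|@itv n c d| = d - c.
Proof.
move=> dn; rewrite -sum1_card.
under eq_bigl do rewrite inE.
rewrite -(big_mkord (fun i => c <= i < d) (fun=> 1)) /=.
rewrite -(big_nat_widen _ _ _ (fun i => c <= i)) // -(big_nat_widenl _ _ _ predT) //.
by rewrite sum_nat_const_nat muln1.
Qed.

Lemma card_ini n c : c <= n -> #|@ini n c| = c.
Proof.
move=> cn; rewrite -[RHS]subn0 -(card_itv 0 cn).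
by apply: eq_card => i; rewrite !inE.
Qed.

(** Induction on the size of e \ f: the least y in e \ f is replaced by some x < y in f \ e. Such an
    x exists, since otherwise f would have fewer vertices than e up to y. *)
Lemma shifted_dominate n (G : {set {set 'I_n}}) (e f : {set 'I_n}) :
  shifted G -> #|e| = #|f| ->
  (forall c, #|e :&: ini c| <= #|f :&: ini c|) -> e \in G -> f \in G.
Proof.
move=> Gs; have [m] := ubnP #|e :\: f|; elim: m e => // m IHm e hm cef dom eG.
have [/eqP e0|[y0 y0ef]] := set_0Vmem (e :\: f).
  have ef : e \subset f by rewrite -setD_eq0.
  by have /eqP <- : e == f by rewrite eqEcard ef cef /=.
pose y := [arg min_(i < y0 in e :\: f) (i : nat)].
have [] : (y \in e :\: f) /\ forall i, i \in e :\: f -> y <= i.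
  by rewrite /y; case: arg_minnP.
rewrite inE => /andP[yf ye] ymin.
have [x /and3P[xf xe xy]|nox] := pickP [pred x | [&& x \in f, x \notin e & x < y]].
  have cs : #|x |: (e :\ y)| = #|e|.
    by rewrite cardsU1 !inE (negPf xe) andbF (cardsD1 y e) ye.
  apply: (IHm (x |: (e :\ y))).
  - rewrite -ltnS; apply: leq_trans hm; rewrite ltnS; apply: proper_card; apply/properP; split.
      apply/subsetP => z; rewrite !inE => /andP[zf /orP[/eqP zx|/andP[_ ze]]].
        by rewrite zx xf in zf.
      by rewrite zf ze.
    by exists y; rewrite !inE ?yf ?ye ?eqxx //= orbF; apply/eqP => yx; rewrite yx ltnn in xy.
  - by rewrite cs.
  (* Below y the new set lies inside f by minimality of y; for c > y the exchange does not change
     the count. *)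
  - move=> c; have [cy|yc] := leqP c y.
      apply/subset_leq_card/subsetP => z; rewrite !inE.
      case/andP=> /orP[/eqP->|/andP[zy ze]] zc; first by rewrite xf.
      rewrite zc andbT; apply: contraTT zc => zf.
      by have := ymin z; rewrite !inE zf ze => /(_ isT); lia.
    apply: leq_trans (dom c).
    have -> : (x |: (e :\ y)) :&: ini c = x |: ((e :&: ini c) :\ y).
      apply/setP => z; rewrite !inE; case: (eqVneq z x) => [->|_] /=; first lia.
      by rewrite andbA.
    rewrite cardsU1 [leqRHS](cardsD1 y) !inE ye yc (negPf xe) andbF; lia.
  - exact: Gs.
have := dom y.+1; rewrite leqNgt => /negP[].
apply: proper_card; apply/properP; split.
  apply/subsetP => z; rewrite !inE => /andP[zf zy]; rewrite zy andbT.
  have := nox z; rewrite /= zf /=; case: (z \in e) => //= /negbT.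
  by move=> zy'; have /eqP : (z : nat) = y by [lia]; rewrite (inj_eq val_inj) => /eqP zz; rewrite -zz zf in yf.
by exists y; rewrite !inE ?ye ?(negPf yf) //= ltnSn.
Qed.

Lemma exists_initial n (S : {set 'I_n}) j : j <= #|S| ->
  exists T : {set 'I_n}, [/\ T \subset S, #|T| = j &
    forall x y, x \in T -> y \in S :\: T -> x < y].
Proof.
elim: j => [|j IHj] jS.
  by exists set0; split; rewrite ?sub0set ?cards0 // => x y; rewrite inE.
have [T [TS cT lT]] := IHj (ltnW jS).
have [|[z0 z0S]] := set_0Vmem (S :\: T).
  by move/eqP; rewrite setD_eq0 => /subset_leq_card; lia.
pose z := [arg min_(i < z0 in S :\: T) (i : nat)].
have [] : (z \in S :\: T) /\ forall i, i \in S :\: T -> z <= i.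
  by rewrite /z; case: arg_minnP.
rewrite inE => /andP[zT zS] zmin.
exists (z |: T); split.
- by rewrite subUset sub1set zS.
- by rewrite cardsU1 zT cT.
move=> x y; rewrite !inE => /orP[/eqP->|xT] /andP[]; rewrite negb_or => /andP[yz yT] yS.
  by rewrite ltn_neqAle eq_sym yz zmin // inE yT.
by apply: lT; rewrite // inE yT.
Qed.

Lemma leq_card_decomp (V : finType) (K Ts : {set {set V}})
    (L : {set V} -> {set {set V}}) :
  (forall S, S \in K -> exists2 T, T \in Ts & (T \subset S) && (S :\: T \in L T)) ->
  #|K| <= \sum_(T in Ts) #|L T|.
Proof.
move=> h; apply: (@leq_trans #|\bigcup_(T in Ts) [set T :|: A | A in L T]|).
  apply/subset_leq_card/subsetP => S /h[T TT /andP[TS SL]].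
  apply/bigcupP; exists T => //; apply/imsetP; exists (S :\: T) => //.
  by rewrite -{1}(setID S T) (setIidPr TS).
apply: (big_ind2 (fun (X : {set {set V}}) b => #|X| <= b)) => [|X b Y c hX hY|T _].
- by rewrite cards0.
- by apply: leq_trans (leq_card_setU _ _).1 _; apply: leq_add.
- exact: leq_imset_card.
Qed.

Section Averaging.
Variable n : nat.
Implicit Types (A B : {set 'I_n}) (L : {set {set 'I_n}}).

Definition num_perms B A := #|[set p : {perm 'I_n} | p @: B == A]|.

Lemma num_perms_tperm B A x y : num_perms B (tperm x y @: A) = num_perms B A.
Proof.
rewrite /num_perms -[RHS](card_imset _ (mulIg (tperm x y))); apply: eq_card => p.
have im (q : {perm 'I_n}) : (q * tperm x y)%g @: B = tperm x y @: (q @: B).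
  by rewrite -imset_comp; apply: eq_imset => z; rewrite /= permM.
apply/idP/imsetP => [|[q]]; rewrite inE.
  move/eqP=> h; exists (p * tperm x y)%g; last by rewrite -mulgA tperm2 mulg1.
  rewrite inE im h -imset_comp -[eqbRHS]imset_id; apply/eqP/eq_imset => z /=.
  by rewrite tpermK.
by move/eqP=> h ->; rewrite inE /= im h.
Qed.

(** Transpositions carry A to A' one element at a time. This is the uniformity of a random image,
    stated by counting. *)
Lemma num_perms_eq B A A' : #|A| = #|A'| -> num_perms B A = num_perms B A'.
Proof.
have [m] := ubnP #|A :\: A'|; elim: m A => // m IHm A hm cA.
have [/eqP e0|[x]] := set_0Vmem (A :\: A').
  have ef : A \subset A' by rewrite -setD_eq0.
  by have /eqP <- : A == A' by rewrite eqEcard ef cA /=.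
rewrite inE => /andP[xA' xA].
have [/eqP|[y]] := set_0Vmem (A' :\: A).
  rewrite setD_eq0 => /subset_leqif_cards; rewrite cA => -[_]; rewrite eqxx => /esym/eqP eA.
  by rewrite eA xA in xA'.
rewrite inE => /andP[yA yA'].
rewrite -(num_perms_tperm B A x y); apply: IHm; last first.
  by rewrite card_imset //; apply: perm_inj.
rewrite -ltnS; apply: leq_trans hm; rewrite ltnS; apply: proper_card; apply/properP; split.
  apply/subsetP => z; rewrite !inE => /andP[zA' /imsetP[w wA zw]]; rewrite zA' /=.
  move: zw; case: tpermP => [wx zy|wy|_ _ ->//]; first by rewrite zy yA' in zA'.
  by rewrite -wy wA in yA.
exists x; rewrite !inE ?xA ?xA' //=; apply/imsetP => -[w wA].
by case: tpermP => [wx xy|wy _|/eqP wx _ xw]; [rewrite -xy xA in yA|rewrite -wy wA in yA|rewrite xw eqxx in wx].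
Qed.

(* The images of [n %/ q] disjoint blocks under a random permutation hit [L]
   at most [k] times, and each image is a uniformly random [q]-set. *)
Lemma card_no_matching L q k : 0 < q <= n ->
  (forall A, A \in L -> #|A| = q) -> ~ has_matching L k.+1 ->
  n * #|L| <= 2 * k * q * 'C(n, q).
Proof.
case/andP=> q0 qn Lq noM; pose t := n %/ q.
have tq : t * q <= n by apply: leq_trunc_div.
(* As t >= 1, the remainder of n modulo q is below t * q; this rounding is the source of the factor
   2. *)
have nt : n <= 2 * (t * q).
  have := divn_eq n q; rewrite -/t; have := ltn_pmod n q0.
  have : 0 < t by rewrite divn_gt0.
  nia.
pose B (i : 'I_t) : {set 'I_n} := itv (i * q) (i.+1 * q).
have cB i : #|B i| = q by rewrite card_itv; have := ltn_ord i; nia.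
have Bdis i i' : i != i' -> [disjoint B i & B i'].
  move=> ii'; apply/pred0P => x /=; rewrite !inE; apply/negP => h.
  by case/eqP: ii'; apply: ord_inj; nia.
have NB i A : #|A| = q -> num_perms (B i) A = num_perms (B i) (B i).
  by move=> cA; apply: num_perms_eq; rewrite cA cB.
(* Every permutation sends [B i] onto exactly one q-set, and all q-sets are hit equally often. *)
have NBC i : 'C(n, q) * num_perms (B i) (B i) = #|{perm 'I_n}|.
  transitivity (\sum_(A : {set 'I_n} | #|A| == q) num_perms (B i) A).
    rewrite (eq_bigr (fun=> num_perms (B i) (B i))) => [|A /eqP]; last exact: NB.
    by rewrite sum_nat_const -[n in 'C(n, q)]card_ord -cardsT -cards_draws;
      congr (_ * _); apply: eq_card => A; rewrite !inE subsetT.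
  rewrite /num_perms -sum1_card (partition_big (fun p : {perm 'I_n} => p @: B i)
     (fun A => #|A| == q)) /=; last first.
    by move=> p _; rewrite card_imset ?cB //; apply: perm_inj.
  by apply: eq_bigr => A _; rewrite sum1dep_card.
have swapc : \sum_(i < t) \sum_(A in L) num_perms (B i) A
    = \sum_(p : {perm 'I_n}) #|[set i : 'I_t | p @: B i \in L]|.
  transitivity (\sum_(i < t) \sum_(p : {perm 'I_n}) (p @: B i \in L : nat)).
    apply: eq_bigr => i _; rewrite /num_perms.
    under eq_bigr do rewrite -sum1dep_card big_mkcond.
    rewrite exchange_big /=; apply: eq_bigr => p _.
    rewrite -big_mkcondr /=; case: (boolP (p @: B i \in L)) => pL.
      rewrite (big_pred1 (p @: B i)) // => A /=.
      by rewrite eq_sym; case: eqP => [->|_]; rewrite ?pL ?andbF.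
    by rewrite big1 // => A /andP[AL /eqP pA]; rewrite pA AL in pL.
  rewrite exchange_big; apply: eq_bigr => p _ /=.
  rewrite -sum1_card [RHS]big_mkcond /=; apply: eq_bigr => i _.
  by rewrite inE; case: (_ \in L).
(* The images of disjoint blocks are disjoint, so those falling in L form a matching of L. *)
have le_k (p : {perm 'I_n}) : #|[set i : 'I_t | p @: B i \in L]| <= k.
  rewrite leqNgt; apply/negP => kp; apply: noM.
  pose X := [set i : 'I_t | p @: B i \in L].
  apply: (@has_matching_fin _ {i | i \in X} L (fun i => p @: B (val i))).
  - by rewrite card_sig.
  - by case=> i /=; rewrite inE.
  move=> i i' ii'; rewrite imset_disjoint; last exact: perm_inj.
  by apply: Bdis; apply: contra_neq ii' => /val_inj.
have [t0|t0] := posnP t; first by move: nt; rewrite t0; lia.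
pose c0 := num_perms (B (Ordinal t0)) (B (Ordinal t0)).
have C0 : 0 < 'C(n, q) by rewrite bin_gt0.
have P0 : 0 < #|{perm 'I_n}| by apply/card_gt0P; exists 1%g.
have c0E i : num_perms (B i) (B i) = c0.
  by apply/eqP; rewrite -(eqn_pmul2l C0) !NBC.
have : \sum_(i < t) \sum_(A in L) num_perms (B i) A = t * (#|L| * c0).
  rewrite (eq_bigr (fun=> #|L| * c0)) ?sum_nat_const ?card_ord // => i _.
  rewrite (eq_bigr (fun=> c0)) ?sum_nat_const // => A AL.
  by rewrite NB ?c0E // Lq.
rewrite swapc => h.
have : t * (#|L| * c0) <= k * ('C(n, q) * c0).
  rewrite -h -(c0E (Ordinal t0)) NBC mulnC -sum_nat_const.
  by apply: leq_sum => p _; apply: le_k.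
have c00 : 0 < c0 by move: P0; rewrite -(NBC (Ordinal t0)) muln_gt0 => /andP[].
rewrite !mulnA leq_pmul2r // => h2.
apply: (@leq_trans (2 * (t * q) * #|L|)); first by rewrite leq_mul2r nt orbT.
have -> : 2 * (t * q) * #|L| = 2 * q * (t * #|L|) by lia.
have -> : 2 * k * q * 'C(n, q) = 2 * q * (k * 'C(n, q)) by lia.
by rewrite leq_mul2l h2 orbT.
Qed.

End Averaging.

(** * The union of large cliques *)

Lemma exists_subset_card (V : finType) (X : {set V}) t : t <= #|X| ->
  exists2 e : {set V}, e \subset X & #|e| = t.
Proof.
move=> tX; have : 0 < #|[set e : {set V} | e \subset X & #|e| == t]|.
  by rewrite cards_draws bin_gt0.
by case/card_gt0P => e; rewrite inE => /andP[eX /eqP ce]; exists e.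
Qed.

Lemma clique_card r s (V : finType) (H : {set {set V}}) S :
  is_clique r s H S -> #|S| = s.
Proof. by case/andP=> /eqP. Qed.

Lemma clique_edge r s (V : finType) (H : {set {set V}}) (S e : {set V}) :
  is_clique r s H S -> e \subset S -> #|e| = r -> e \in H.
Proof.
by case/andP=> _ /forallP/(_ e)/implyP h eS ce; apply: h; rewrite eS ce eqxx.
Qed.

Section CliqueUnion.
Variables (V : finType) (H : {set {set V}}) (r s k : nat).
Hypotheses (r0 : 0 < r) (Hr : is_rgraph r H).

(** Boolean form of [has_matching] over finite functions, so that extremal choices can range over
    matchings. *)
Definition matchf t (M : {ffun 'I_t -> {set V}}) : bool :=
  [forall i, M i \in H] &&
  [forall i, forall i', (i != i') ==> [disjoint M i & M i']].

Lemma matchfP t (M : {ffun 'I_t -> {set V}}) :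
  reflect ((forall i, M i \in H) /\
           (forall i i', i != i' -> [disjoint M i & M i'])) (matchf M).
Proof.
apply: (iffP andP) => -[h h']; split.
- exact/forallP.
- by move=> i i'; move/forallP: h' => /(_ i)/forallP/(_ i')/implyP.
- exact/forallP.
- by apply/forallP => i; apply/forallP => i'; apply/implyP; apply: h'.
Qed.

Lemma has_matchingP t :
  reflect (has_matching H t) [exists M : {ffun 'I_t -> {set V}}, matchf M].
Proof.
apply: (iffP existsP) => [[M /matchfP h]|[A [h h']]]; first by exists M.
exists (finfun A); apply/matchfP; split=> [i|i i']; rewrite !ffunE //.
exact: h'.
Qed.

Definition verts t (M : {ffun 'I_t -> {set V}}) := \bigcup_i M i.

Lemma card_vertsD t (M : {ffun 'I_t -> {set V}}) T : matchf M ->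
  \sum_i #|M i :\: T| = #|verts M :\: T|.
Proof.
case/matchfP=> _ Md; rewrite /verts setDE setIC big_distrr /=.
rewrite -sum1_card partition_disjoint_bigcup /= => [|i i' /Md].
  by apply: eq_bigr => i _; rewrite sum1_card setDE setIC.
by rewrite -!setI_eq0 => /eqP d; rewrite setIACA d setI0.
Qed.

Lemma card_verts t (M : {ffun 'I_t -> {set V}}) : matchf M -> #|verts M| = r * t.
Proof.
move=> Mm; rewrite -[verts M]setD0 -card_vertsD //.
rewrite (eq_bigr (fun=> r)) ?sum_nat_const ?card_ord 1?mulnC // => i _.
by rewrite setD0 Hr //; case/matchfP: Mm.
Qed.

(** Within a clique T, a vertex of a matching edge can be traded for an uncovered vertex of T: the
    resulting r-set still lies in T. *)
Lemma exchange t (M : {ffun 'I_t -> {set V}}) T i0 y z :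
  matchf M -> is_clique r s H T -> M i0 \subset T -> y \in M i0 ->
  z \in T -> z \notin verts M ->
  exists2 M' : {ffun 'I_t -> {set V}}, matchf M' & verts M' = z |: (verts M :\ y).
Proof.
move=> /matchfP[MH Md] KT MT yM zT zM.
have nz i : z \notin M i by apply: contra zM => zi; apply/bigcupP; exists i.
exists [ffun i => if i == i0 then z |: (M i0 :\ y) else M i].
  apply/matchfP; split=> [i|i i'].
    rewrite ffunE; case: eqP => // _; apply: (clique_edge KT).
      by rewrite subUset sub1set zT (subset_trans (subD1set _ _)).
    by rewrite cardsU1 !inE (negPf (nz i0)) andbF -(Hr (MH i0)) [RHS](cardsD1 y) yM.
  have d i1 : i1 != i0 -> [disjoint z |: (M i0 :\ y) & M i1].
    move=> ne; apply/pred0P => w /=; apply/negbTE/negP; rewrite !inE.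
    case/andP=> /orP[/eqP->|/andP[_ w0]] w1; first by rewrite (negPf (nz i1)) in w1.
    by have := disjointFr (Md _ _ ne) w1; rewrite w0.
  rewrite !ffunE => ii'; case: (eqVneq i i0) ii' => [->|ne] ii'.
    by rewrite eq_sym (negPf ii') d // eq_sym.
  case: (eqVneq i' i0) => [_|_]; last exact: Md.
  by rewrite disjoint_sym d.
apply/setP => w; rewrite !inE; apply/bigcupP/idP => [[i _]|].
  rewrite ffunE; case: eqP => [_|/eqP ne wi].
    rewrite !inE => /orP[->//|/andP[-> w0]]; apply/orP; right.
    by apply/bigcupP; exists i0.
  apply/orP; right; apply/andP; split; last by apply/bigcupP; exists i.
  by apply/eqP => wy; have := disjointFr (Md _ _ ne) wi; rewrite wy yM.
case/orP=> [wz|/andP[wy /bigcupP[i _ wi]]].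
  by exists i0; rewrite // ffunE eqxx !inE wz.
by exists i; rewrite // ffunE; case: eqP => // ii; rewrite !inE wy -ii wi orbT.
Qed.

(* Each edge inside [S] contributes [r] vertices missed by [T], and each edge
   not inside [T] contributes at least one. *)
Lemma contained_edges t (M : {ffun 'I_t -> {set V}}) (S T : {set V}) :
  t <= k -> (r - 1) * k + r <= s -> matchf M -> is_clique r s H T ->
  #|T :\: verts M| < r ->
  (forall i, M i \subset S -> [disjoint M i & T]) ->
  (r - 1) * #|[set i | M i \subset S]| < #|[set i | M i \subset T]|.
Proof.
move=> tk ks Mm KT outT dis.
have : \sum_(i < t) (r * (M i \subset S) + 1) <=
       \sum_(i < t) (#|M i :\: T| + (M i \subset S) + (M i \subset T)).
  apply: leq_sum => i _; case: (boolP (M i \subset S)) => iS.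
    rewrite (setDidPl (dis _ iS)) Hr; last by case/matchfP: Mm.
    lia.
  case: (boolP (M i \subset T)) => iT; first lia.
  by have := iT; rewrite -setD_eq0 -card_gt0; lia.
have ct (X : {set V}) : \sum_(i < t) (M i \subset X) = #|[set i | M i \subset X]|.
  by rewrite -sum1_card [RHS]big_mkcond /=; apply: eq_bigr => i _; rewrite inE; case: (_ \subset _).
rewrite !big_split /= -big_distrr /= !ct sum_nat_const card_ord muln1 card_vertsD //.
(* T meets M in more than s - r >= (r - 1) k vertices, hence misses fewer than t of its r * t
   vertices. *)
have := cardsID T (verts M); have := cardsID (verts M) T.
rewrite (clique_card KT) card_verts // setIC.
have : (r - 1) * t <= (r - 1) * k by rewrite leq_mul2l tk orbT.
move: r0 outT ks; set a := #|_|; set b := #|_|; set c := #|_|; set d := #|_|; set e := #|_|.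
case: (r) => // r' _; rewrite subn1 /= !mulSn; lia.
Qed.

Lemma clique_union_card : ~ has_matching H k.+1 -> (r - 1) * k + r <= s ->
  #|cover [set S | is_clique r s H S]| <= r * k + r - 1.
Proof.
move=> noM ks; rewrite leqNgt; apply/negP => big.
have exm : exists m, [exists M : {ffun 'I_m -> {set V}}, matchf M].
  exists 0; apply/has_matchingP; exists (fun=> set0); split=> [[]|[]] //.
have ubm m : [exists M : {ffun 'I_m -> {set V}}, matchf M] -> m <= k.
  move/has_matchingP => hm; rewrite leqNgt; apply/negP => km.
  exact: noM (has_matching_leq km hm).
case: (ex_maxnP exm ubm) => m /existsP[M0 M0m] maxm.
have mk : m <= k by apply: ubm; apply/existsP; exists M0.
have out M S : @matchf m M -> is_clique r s H S -> #|S :\: verts M| < r.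
  move=> Mm KS; rewrite ltnNge; apply/negP => /exists_subset_card[e eX ce].
  have [MH Md] := matchfP _ Mm.
  have eM i : [disjoint e & M i].
    apply/pred0P => w /=; apply/negbTE/negP => /andP[we wi].
    by have := subsetP eX _ we; rewrite inE => /andP[/bigcupP[]]; exists i.
  have : m.+1 <= m; last by rewrite ltnn.
  apply: maxm; apply/has_matchingP.
  apply: (@has_matching_fin _ (option 'I_m) _
    (fun o => if o is Some i then M i else e)).
  - by rewrite card_option card_ord.
  - case=> [i|]; [exact: MH|apply: (clique_edge KS) => //; apply: subset_trans eX (subsetDl _ _)].
  - move=> [i|] [i'|] //= ne; [exact: Md | by rewrite disjoint_sym].
(* S and M together cover at most (r - 1) + r m vertices, too few to contain all cliques. *)
have newT M S : @matchf m M -> is_clique r s H S ->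
    exists2 T, is_clique r s H T & ~~ (T \subset S :|: verts M).
  move=> Mm KS; have : ~~ (cover [set S | is_clique r s H S] \subset S :|: verts M).
    apply: contraL big => /subset_leq_card le; rewrite -leqNgt; apply: (leq_trans le).
    have -> : S :|: verts M = (S :\: verts M) :|: verts M.
      by apply/setP => w; rewrite !inE; case: (w \in verts M); rewrite ?orbT.
    apply: leq_trans (leq_card_setU _ _).1 _; rewrite card_verts //.
    have := out _ _ Mm KS; have : r * m <= r * k by rewrite leq_mul2l mk orbT.
    lia.
  case/subsetPn => w /bigcupP[T]; rewrite inE => KT wT wn; exists T => //.
  by apply/subsetPn; exists w.
have [S0 KS0] : exists S, is_clique r s H S.
  have : cover [set S | is_clique r s H S] != set0 by rewrite -card_gt0; lia.
  by case/set0Pn => w /bigcupP[S]; rewrite inE; exists S.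
pose P1 (c : {ffun 'I_m -> {set V}} * {set V}) := matchf c.1 && is_clique r s H c.2.
pose p (c : {ffun 'I_m -> {set V}} * {set V}) := #|c.2 :\: verts c.1|.
have P10 : P1 (M0, S0) by rewrite /P1 M0m.
case: (arg_maxnP p P10) => -[M1 S1] /andP[/= M1m KS1] max1.
have [T1 KT1 T1n] := newT _ _ M1m KS1.
(* The second criterion is optimised only among configurations that attain the maximum of the
   first. *)
pose P2 (c : {ffun 'I_m -> {set V}} * {set V} * {set V}) :=
  [&& P1 c.1, p c.1 == p (M1, S1), is_clique r s H c.2 &
      ~~ (c.2 \subset c.1.2 :|: verts c.1.1)].
pose p2 (c : {ffun 'I_m -> {set V}} * {set V} * {set V}) := #|c.2 :\: verts c.1.1|.
have P20 : P2 (M1, S1, T1) by rewrite /P2 /P1 /= M1m KS1 eqxx KT1.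
case: (arg_maxnP p2 P20) => -[[M S] T] /and4P[/= /andP[/= Mm KS] /eqP pMS KT].
rewrite -pMS in max1 => /subsetPn[z zT]; rewrite !inE negb_or => /andP[zS zM] max2.
(* If such an edge met S in y, trading y for z would uncover y, while z is not in S: S would gain an
   uncovered vertex. *)
have dT i : M i \subset T -> [disjoint M i & S].
  move=> iT; rewrite -setI_eq0; apply/negPn/negP => /set0Pn[y]; rewrite inE => /andP[yi yS].
  have [M' M'm vM'] := exchange Mm KT iT yi zT zM.
  have := max1 (M', S); rewrite /P1 /= M'm KS => /(_ isT); rewrite /p /= vM'.
  apply/negP; rewrite -ltnNge; apply: proper_card; apply/properP; split.
    apply/subsetP => w; rewrite !inE => /andP[wM wS]; rewrite wS (negPf wM) andbF orbF andbT.
    by apply: contraNneq zS => <-.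
  exists y; rewrite !inE ?yS ?eqxx ?andbT /=.
    by rewrite orbF; apply: contraNneq zS => <-.
  by rewrite negbK; apply/bigcupP; exists i.
(* Otherwise T would have all the uncovered vertices of S and also z, against the first
   criterion. *)
have [x xS] : exists2 x, x \in S :\: verts M & x \notin T.
  apply/subsetPn; apply/negP => ST.
  have := max1 (M, T); rewrite /P1 /= Mm KT => /(_ isT); rewrite /p /=.
  apply/negP; rewrite -ltnNge; apply: proper_card; apply/properP; split.
    by apply/subsetP => w wS; rewrite inE (subsetP ST _ wS) andbT; move: wS; rewrite inE => /andP[].
  by exists z; rewrite !inE ?zM ?zT ?(negPf zS) ?andbF.
move: xS; rewrite inE => /andP[xM xS] xT.
(* Trading y for x leaves the first criterion unchanged, as S loses x and gains y, but T gains y and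
   loses nothing. *)
have dS i : M i \subset S -> [disjoint M i & T].
  move=> iS; rewrite -setI_eq0; apply/negPn/negP => /set0Pn[y]; rewrite inE => /andP[yi yT].
  have yM : y \in verts M by apply/bigcupP; exists i.
  have [M' M'm vM'] := exchange Mm KS iS yi xS xM.
  have yx : y != x by apply: contraTneq yM => ->.
  have := max2 (M', S, T); rewrite /P2 /P1 /= M'm KS KT /=.
  have -> : p (M', S) == p (M1, S1).
    rewrite -pMS /p /= vM'.
    have -> : S :\: (x |: (verts M :\ y)) = y |: ((S :\: verts M) :\ x).
      apply/setP => w; rewrite !inE; case: (eqVneq w y) => [->|wy].
        by rewrite (negPf yx) /= (subsetP iS _ yi).
      by case: (w == x).
    by rewrite cardsU1 [eqbRHS](cardsD1 x) !inE yM xM xS andbF /=.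
  have -> /= : ~~ (T \subset S :|: verts M').
    apply/subsetPn; exists z => //; rewrite vM' !inE (negPf zS) (negPf zM) andbF orbF /=.
    by apply: contraNneq xT => <-.
  move/(_ isT); rewrite /p2 /= vM'.
  apply/negP; rewrite -ltnNge; apply: proper_card; apply/properP; split.
    apply/subsetP => w; rewrite !inE => /andP[wM wT]; rewrite wT (negPf wM) andbF orbF andbT.
    by apply: contraNneq xT => <-.
  by exists y; rewrite !inE ?yT ?yM ?eqxx ?andbT /= ?orbF.
have h1 := contained_edges mk ks Mm KT (out _ _ Mm KT) dS.
have h2 := contained_edges mk ks Mm KS (out _ _ Mm KS) dT.
(* With r >= 2 the inequalities [h1] and [h2] make each of the two edge counts smaller than the
   other. *)
have r1 : 0 < r - 1.
  rewrite subn_gt0; apply: leq_ltn_trans (out _ _ Mm KT).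
  by apply/card_gt0P; exists z; rewrite inE zM zT.
have := leq_ltn_trans (leq_pmull _ r1) h1; have := leq_ltn_trans (leq_pmull _ r1) h2.
by move=> /ltn_trans h /h; rewrite ltnn.
Qed.

End CliqueUnion.

(** * Relabelling of the vertices, cliques of the extremal graphs, and part (III) *)

Lemma transport_rgraph (V : finType) n r s k (H : {set {set V}}) :
  #|V| = n -> is_rgraph r H -> ~ has_matching H k ->
  exists H' : {set {set 'I_n}}, [/\ is_rgraph r H', ~ has_matching H' k &
    num_cliques r s H <= num_cliques r s H'].
Proof.
move=> cV Hr noM; case: n / cV.
pose f : V -> 'I_#|V| := @enum_rank V; pose g : 'I_#|V| -> V := @enum_val V predT.
have fK : cancel f g := @enum_rankK V; have gK : cancel g f := @enum_valK V.
have fb : bijective f by exists g.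
have gb : bijective g by exists f.
have cf (X : {set 'I_#|V|}) : #|f @^-1: X| = #|X|.
  exact: on_card_preimset (onW_bij _ fb).
have cg (X : {set V}) : #|g @^-1: X| = #|X|.
  exact: on_card_preimset (onW_bij _ gb).
exists [set X : {set 'I_#|V|} | f @^-1: X \in H]; split.
- by move=> X; rewrite inE => /Hr; rewrite cf.
- case=> A [AH Ad]; apply: noM; exists (fun i => f @^-1: A i); split=> [i|i i' ne].
    by have := AH i; rewrite inE.
  apply/pred0P => w /=; rewrite !inE; apply/negP => /andP[w1 w2].
  by have := disjointFr (Ad _ _ ne) w1; rewrite w2.
have ginj : injective (fun S : {set V} => g @^-1: S).
  by move=> S S' /setP e; apply/setP => x; have := e (f x); rewrite !inE fK.
rewrite /num_cliques -(card_imset _ ginj); apply: subset_leq_card.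
apply/subsetP => _ /imsetP[S + ->]; rewrite !inE => KS.
apply/andP; split; first by rewrite cg (clique_card KS).
apply/forallP => e; apply/implyP => /andP[/subsetP eS /eqP ce]; rewrite inE.
apply: (clique_edge KS); last by rewrite cf.
by apply/subsetP => x; rewrite inE => /eS; rewrite inE fK.
Qed.

(** An r-subset of S omits only s - r of its vertices, so it keeps at least a of those in the
    segment. *)
Lemma frankl_clique n k r s a (S : {set 'I_n}) : #|S| = s -> a <= r <= s ->
  s - r + a <= #|S :&: ini (a * k + a - 1)| -> is_clique r s (frankl n k r a) S.
Proof.
move=> cS /andP[ar rs] Sm; apply/andP; split; first by rewrite cS.
apply/forallP => e; apply/implyP => /andP[eS /eqP ce]; rewrite inE ce eqxx /=.
change (a <= #|e :&: ini (a * k + a - 1)|).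
have := cardsID (ini (a * k + a - 1)) e; have := cardsID (ini (a * k + a - 1)) S.
have := subset_leq_card (setSD (ini (a * k + a - 1)) eS).
by move: Sm; rewrite cS ce; lia.
Qed.

Lemma num_cliques_frankl_top n k r s : 0 < r <= s -> r * k + r - 1 <= n ->
  num_cliques r s (frankl n k r r) = 'C(r * k + r - 1, s).
Proof.
move=> /andP[r0 rs] Mn; set M := r * k + r - 1 in Mn *.
rewrite -[M in 'C(M, _)](card_ini Mn) -cards_draws; apply: eq_card => S; rewrite !inE.
apply/idP/andP => [KS|[SM cS]].
  rewrite (clique_card KS) eqxx; split=> //; apply/subsetP => x xS.
  have [|e eS ce] := @exists_subset_card _ (S :\ x) r.-1.
    by have := cardsD1 x S; rewrite xS (clique_card KS); lia.
  have xe : x \notin e by apply/negP => /(subsetP eS); rewrite !inE eqxx.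
  have ce' : #|x |: e| = r by rewrite cardsU1 xe ce; lia.
  have : x |: e \in frankl n k r r.
    apply: (clique_edge KS) => //; rewrite subUset sub1set xS.
    exact: subset_trans eS (subD1set _ _).
  rewrite inE ce' eqxx /= -[r in r <= _]ce' => le.
  have /eqP/setIidPl/subsetP : (x |: e) :&: ini M == x |: e by rewrite eqEcard subsetIl.
  by apply; rewrite !inE eqxx.
apply: frankl_clique; rewrite ?leqnn ?rs //; first exact/eqP.
by rewrite (setIidPl SM) (eqP cS); lia.
Qed.

(** All cliques are s-subsets of one set W of size M. If some s-subset of W is not a clique, W
    contains a non-edge e of size r, and all C(r k - 1, s - r) s-subsets of W through e are lost. *)
Lemma cliques_top (V : finType) (H : {set {set V}}) n k r s :
  #|V| = n -> 0 < r -> is_rgraph r H -> ~ has_matching H k.+1 ->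
  (r - 1) * k + r <= s -> r * k + r - 1 <= n ->
  num_cliques r s H = 'C(r * k + r - 1, s) \/
  num_cliques r s H <= 'C(r * k + r - 1, s) - 'C(r * k - 1, s - r).
Proof.
move=> cV r0 Hr noM ks Mn; set M := r * k + r - 1.
set K := [set S | is_clique r s H S].
have cU : #|cover K| <= M by apply: clique_union_card.
have rs : r <= s by lia.
have [W UW cW] : exists2 W : {set V}, cover K \subset W & #|W| = M.
  have [|X XU cX] := @exists_subset_card _ (~: cover K) (M - #|cover K|).
    by have := cardsC (cover K); rewrite cV; lia.
  exists (cover K :|: X); first exact: subsetUl.
  rewrite cardsU disjoint_setI0 ?cards0; first lia.
  by rewrite disjoint_sym disjoints_subset.
pose D := [set S : {set V} | S \subset W & #|S| == s].
have cD : #|D| = 'C(M, s) by rewrite cards_draws cW.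
have KD : K \subset D.
  apply/subsetP => S SK; rewrite inE (subset_trans _ UW) ?bigcup_sup //=.
  by move: SK; rewrite inE => /clique_card ->.
have [DK|/subsetPn[S]] := boolP (D \subset K).
  by left; rewrite -cD /num_cliques -/K; apply/eqP; rewrite eqn_leq !subset_leq_card.
rewrite !inE => /andP[SW cS]; rewrite /is_clique cS negb_forall => /existsP[e].
rewrite negb_imply => /andP[/andP[eS /eqP ce] eH]; right.
pose X := [set e :|: A | A in [set A : {set V} | A \subset W :\: e & #|A| == s - r]].
have eW : e \subset W := subset_trans eS SW.
have cX : #|X| = 'C(r * k - 1, s - r).
  rewrite card_in_imset => [|A A']; last first.
    rewrite !inE !subsetD => /andP[/andP[_ dA] _] /andP[/andP[_ dA'] _] /setP eq.
    apply/setP => x; have := eq x; rewrite !inE.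
    case xe : (x \in e) => //= _.
    by rewrite (disjointFl dA xe) (disjointFl dA' xe).
  rewrite cards_draws; congr ('C(_, _)); have := cardsID e W.
  by rewrite (setIidPr eW) ce cW /M; lia.
have XD : X \subset D.
  apply/subsetP => _ /imsetP[A + ->]; rewrite inE subsetD => /andP[/andP[AW dA] /eqP cA].
  rewrite inE subUset eW AW /= cardsU setIC disjoint_setI0 // cards0 ce cA.
  by apply/eqP; lia.
rewrite -cX -cD -(cardsDS XD); apply: subset_leq_card.
apply/subsetP => S' S'K; rewrite inE (subsetP KD) // andbT.
apply/imsetP => -[A _ eqS]; move/negP: eH; apply; move: S'K; rewrite inE => KS'.
by apply: (clique_edge KS') => //; rewrite eqS subsetUl.
Qed.

(** * Cliques of shifted graphs *)

Lemma card_ini_le n c : #|@ini n c| <= c.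
Proof.
have [cn|nc] := leqP c n; first by rewrite card_ini.
by apply: leq_trans (max_card _) _; rewrite card_ord ltnW.
Qed.

Lemma card_disjointU (V : finType) (A B : {set V}) :
  A :&: B = set0 -> #|A :|: B| = #|A| + #|B|.
Proof. by move=> d; rewrite cardsU d cards0 subn0. Qed.

(** The q-sets meeting a given d-set number at most d C(n - 1, q - 1), which is (d q / n) C(n,
    q). *)
Lemma bin_sub_le n d q : 0 < q -> d <= n ->
  n * 'C(n, q) <= n * 'C(n - d, q) + d * q * 'C(n, q).
Proof.
move=> q0 dn.
have h : 'C(n, q) <= 'C(n - d, q) + d * 'C(n.-1, q.-1).
  elim: d dn => [|d IHd] dn; first by rewrite subn0 mul0n addn0.
  apply: (leq_trans (IHd (ltnW dn))); rewrite mulSn addnA leq_add2r.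
  rewrite (_ : n - d = (n - d.+1).+1); last lia.
  rewrite -[q in leqLHS](prednK q0) binS prednK // leq_add2l; apply: leq_bin2l; lia.
have e : n * 'C(n.-1, q.-1) = q * 'C(n, q) by rewrite mul_bin_diag prednK //; case: (n) dn.
apply: (leq_trans (leq_mul (leqnn n) h)).
by rewrite mulnDr leq_add2l mulnCA e mulnA.
Qed.

Lemma shifted_dominateU n (G : {set {set 'I_n}}) (B B' A : {set 'I_n}) :
  shifted G -> #|B| = #|B'| -> [disjoint B & A] -> [disjoint B' & A] ->
  (forall c, #|B :&: ini c| <= #|B' :&: ini c|) -> B :|: A \in G -> B' :|: A \in G.
Proof.
move=> Gs cB dB dB' dom.
have cU (X : {set 'I_n}) c : [disjoint X & A] ->
    #|(X :|: A) :&: ini c| = #|X :&: ini c| + #|A :&: ini c|.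
  move=> dX; rewrite setIUl card_disjointU //.
  by rewrite setIACA (disjoint_setI0 dX) set0I.
apply: shifted_dominate => //.
  by rewrite !cardsU !disjoint_setI0 // cards0 cB.
by move=> c; rewrite !cU // leq_add2r.
Qed.

Lemma glued_disjoint n (B A B' A' : {set 'I_n}) c :
  B \subset ini c -> B' \subset ini c ->
  [disjoint A & @ini n c] -> [disjoint A' & @ini n c] ->
  [disjoint B & B'] -> [disjoint A & A'] -> [disjoint B :|: A & B' :|: A'].
Proof.
move=> /subsetP Bc /subsetP B'c dA dA' dB dAA'.
apply/pred0P => x /=; rewrite !inE; apply/negP => /andP[/orP[x1|x1] /orP[x2|x2]].
- by rewrite (disjointFr dB x1) in x2.
- by have := Bc _ x1; rewrite (disjointFr dA' x2).
- by have := B'c _ x2; rewrite (disjointFr dA x1).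
- by rewrite (disjointFr dAA' x1) in x2.
Qed.

Section Shifted.
Variables (n k r s : nat) (H : {set {set 'I_n}}).
Hypotheses (Hs : shifted H) (noM : ~ has_matching H k.+1) (rs : r <= s).

(** Otherwise the i-th of the last r vertices of S has label at least i (k + 1) - 1. By shiftedness
    each residue class modulo k + 1 among the first r (k + 1) vertices is then an edge, and these
    classes form a matching of size k + 1. *)
Lemma clique_initial a (S : {set 'I_n}) : 0 < a <= r -> (a - 1) * k <= s - r ->
  r * k.+1 <= n -> is_clique r s H S -> s - r + a <= #|S :&: ini (r * k + r - 1)|.
Proof.
move=> /andP[a0 ar] ak rn KS; rewrite leqNgt; apply/negP => Sfew.
have cS := clique_card KS.
have [|T [TS cT lT]] := @exists_initial _ S (s - r); first by rewrite cS leq_subr.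
set F := S :\: T in lT.
have cF : #|F| = r by rewrite cardsDS // cS cT; lia.
have FH : F \in H by apply: (clique_edge KS) => //; apply: subsetDl.
(* If i of these vertices were below c, all of T would be too. For i >= a this contradicts [Sfew];
   for i < a, s - r + i >= i k + i vertices would not fit below c. *)
have hF i : 0 < i <= r -> #|F :&: ini (i * k + i - 1)| < i.
  move=> /andP[i0 ir]; rewrite ltnNge; apply/negP => Fi.
  set c := i * k + i - 1 in Fi *.
  have /card_gt0P[y] : 0 < #|F :&: ini c| by apply: leq_trans Fi.
  rewrite !inE => /andP[yF yc].
  have le : s - r + i <= #|S :&: ini c|.
    have -> : S :&: ini c = T :|: (F :&: ini c).
      apply/setP => x; rewrite !inE; case xT: (x \in T) => //=.
      by rewrite (subsetP TS _ xT) /=; apply: ltn_trans yc; apply: lT; rewrite ?inE.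
    rewrite card_disjointU ?cT ?leq_add2l //.
    by apply/setP => x; rewrite !inE; case: (x \in T).
  have [ai|ia] := leqP a i.
    have : #|S :&: @ini n c| <= #|S :&: @ini n (r * k + r - 1)|.
      apply/subset_leq_card/setIS/subsetP => x; rewrite !inE => /leq_trans -> //.
      have := leq_mul ir (leqnn k); rewrite /c; lia.
    lia.
  have : #|S :&: @ini n c| <= c.
    by apply: leq_trans (card_ini_le n c); apply/subset_leq_card/subsetIr.
  have : i * k <= (a - 1) * k by apply: leq_mul => //; lia.
  by rewrite {2}/c; lia.
have pf (l : 'I_k.+1) (i : 'I_r) : l + i * k.+1 < n.
  apply: leq_trans rn; have := leq_mul (ltn_ord i) (leqnn k.+1); have := ltn_ord l; lia.
pose f (l : 'I_k.+1) (i : 'I_r) : 'I_n := Ordinal (pf l i).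
have finj l : injective (f l).
  move=> i i' /(congr1 val) /= /addnI /eqP; rewrite eqn_mul2r /= => /eqP; exact: val_inj.
apply: noM; exists (fun l => f l @: setT); split=> [l|l l' ll'].
  apply: (shifted_dominate Hs _ _ FH) => [|c].
    by rewrite card_imset // cardsT card_ord.
  set w := #|F :&: ini c|.
  have [->//|w0] := posnP w.
  have wr : w <= r by rewrite -cF; apply/subset_leq_card/subsetIl.
  have wc : w * k + w - 1 < c.
    rewrite ltnNge; apply/negP => cw.
    have := hF w; rewrite w0 wr => /(_ isT); apply/negP; rewrite -leqNgt.
    by apply/subset_leq_card/setIS/subsetP => x; rewrite !inE => /leq_trans ->.
  rewrite -[w](card_ini wr) -(card_imset _ (finj l)); apply: subset_leq_card.
  apply/subsetP => _ /imsetP[i + ->]; rewrite !inE => iw; apply/andP; split.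
    by apply/imsetP; exists i.
  apply: leq_ltn_trans wc => /=; have := ltn_ord l.
  have := leq_mul iw (leqnn k.+1); lia.
apply/pred0P => x /=; apply/negP => /andP[/imsetP[i _ ->] /imsetP[i' _ /(congr1 val) /= e]].
case/eqP: ll'; apply: val_inj; have := congr1 (modn^~ k.+1) e.
by rewrite /= ![_ + _ * _]addnC !modnMDl !modn_small.
Qed.

Definition links a (T : {set 'I_n}) : {set {set 'I_n}} :=
  [set A : {set 'I_n} | [&& #|A| == r - a, is_clique r s H (T :|: A) &
     [forall x in T, forall y in A, x < y]]].

Lemma linksP a T A : A \in links a T ->
  [/\ #|A| = r - a, is_clique r s H (T :|: A) & forall x y, x \in T -> y \in A -> x < y].
Proof.
rewrite inE => /and3P[/eqP cA KA /forall_inP h]; split=> // x y xT yA.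
by have /forall_inP := h x xT; apply.
Qed.

(** Given k + 1 disjoint completions, they all lie beyond the first a (k + 1) vertices, since T
    reaches label a (k + 1) - 1. Shifting the last a vertices [B0] of T to disjoint a-sets inside
    that segment gives k + 1 disjoint edges. *)
Lemma links_no_matching a (T : {set 'I_n}) :
  0 < a <= r -> (a - 1) * k <= s - r -> a * k.+1 <= n ->
  #|T| = s - r + a -> ~~ (T \subset ini (a * k + a - 1)) ->
  ~ has_matching (links a T) k.+1.
Proof.
move=> /andP[a0 ar] ak an cT /subsetPn[y0 y0T]; rewrite inE -leqNgt => y0m [A [AL Ad]].
have [|T' [T'T cT' lT]] := @exists_initial _ T (s - r); first by rewrite cT leq_addr.
set B0 := T :\: T' in lT.
have cB0 : #|B0| = a by rewrite cardsDS // cT cT' addKn.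
have B0small c : c <= a * k + a - 1 -> #|B0 :&: ini c| < a.
  move=> cm; rewrite ltnNge; apply/negP => le.
  have /eqP/setIidPl/subsetP sub : B0 :&: ini c == B0 by rewrite eqEcard subsetIl cB0.
  have y0B : y0 \notin B0 by apply/negP => /sub; rewrite inE; lia.
  have y0T' : y0 \in T' by move: y0B; rewrite inE y0T andbT negbK.
  have /card_gt0P[y yB] : 0 < #|B0| by rewrite cB0.
  by have := lT _ _ y0T' yB; have := sub _ yB; rewrite inE; lia.
(* For w < a the w-th vertex of [B0] has label at least (a - 1) k + w - 1, and the last one at least
   a (k + 1) - 1. So a - 1 consecutive vertices from (a - 1) i on, and one of the top k + 1 of the
   segment, lie low enough. *)
pose B (i : 'I_k.+1) : {set 'I_n} :=
  itv ((a - 1) * i) ((a - 1) * i.+1) :|: itv ((a - 1) * k.+1 + i) ((a - 1) * k.+1 + i.+1).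
have aE : a * k.+1 = (a - 1) * k.+1 + k.+1 by rewrite mulnBl mul1n subnK // leq_pmull.
have iE (i : 'I_k.+1) : (a - 1) * i.+1 <= (a - 1) * k.+1 by rewrite leq_mul2l ltn_ord orbT.
have cB i : #|B i| = a.
  rewrite card_disjointU.
    rewrite !card_itv; try (have := iE i; have := ltn_ord i; lia).
  by apply/setP => x; rewrite !inE; apply/negP; have := iE i; lia.
have Bini i : B i \subset ini (a * k.+1).
  by apply/subsetP => x; rewrite !inE; have := iE i; have := ltn_ord i; lia.
have Aini i : [disjoint A i & @ini n (a * k.+1)].
  apply/pred0P => x /=; rewrite !inE; apply/negP => /andP[xA xa].
  by have [_ _ /(_ _ _ y0T xA)] := linksP (AL i); rewrite mulnS in xa; lia.
have disB (X : {set 'I_n}) i : X \subset ini (a * k.+1) -> [disjoint X & A i].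
  by move=> Xs; apply: disjointWl Xs _; rewrite disjoint_sym.
apply: noM; exists (fun i => B i :|: A i); split=> [i|i i' ii'].
  have [cA KA lA] := linksP (AL i).
  have dB0 : [disjoint B0 & A i].
    apply/pred0P => x /=; rewrite !inE; apply/negP => /andP[/andP[_ xT] xA].
    by have := lA _ _ xT xA; rewrite ltnn.
  apply: (@shifted_dominateU _ _ B0) => //; rewrite ?cB0 ?cB //; first exact: disB.
    move=> c; have [cm|mc] := leqP c (a * k + a - 1); last first.
      apply: leq_trans (subset_leq_card (subsetIl _ _)) _.
      rewrite cB0 -(cB i) (setIidPl _) //; apply: subset_trans (Bini i) _.
      by apply/subsetP => x; rewrite !inE mulnS; lia.
    have := B0small _ cm; set w := #|B0 :&: ini c| => wa.
    have [->//|w0] := posnP w.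
    have /card_gt0P[y] : 0 < #|B0 :&: ini c| by [].
    rewrite inE => /andP[yB]; rewrite inE => yc.
    have cw : s - r + w <= c.
      apply: leq_trans (card_ini_le n c).
      rewrite -cT' /w -[leqLHS](_ : #|T' :|: (B0 :&: ini c)| = _); last first.
        rewrite card_disjointU //.
        by apply/setP => x; rewrite !inE; case: (x \in T').
      apply/subset_leq_card/subsetP => x; rewrite !inE => /orP[xT'|/andP[]//].
      by apply: ltn_trans yc; apply: lT.
    have aik : (a - 1) * i <= (a - 1) * k by rewrite leq_mul2l -ltnS ltn_ord orbT.
    have := iE i => iEi; have := mulnS (a - 1) i => iS.
    rewrite -[w](_ : #|@itv n ((a - 1) * i) ((a - 1) * i + w)| = w); last first.
      by rewrite card_itv; lia.
    by apply/subset_leq_card/subsetP => x; rewrite !inE; lia.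
  apply: (clique_edge KA); first by rewrite setSU ?subsetDl.
  by rewrite card_disjointU ?disjoint_setI0 // cB0 cA; lia.
have [cA KA lA] := linksP (AL i); have [cA' KA' lA'] := linksP (AL i').
apply: (@glued_disjoint _ _ _ _ _ (a * k.+1)) => //; last exact: Ad.
wlog lt : i i' ii' {KA lA cA KA' lA' cA'} / i < i'.
  move=> wl; have [lt|gt|/val_inj eq] := ltngtP i i'; first exact: wl.
    by rewrite disjoint_sym wl // eq_sym.
  by rewrite eq eqxx in ii'.
have le : (a - 1) * i.+1 <= (a - 1) * i' by rewrite leq_mul2l lt orbT.
apply/pred0P => x /=; rewrite !inE; apply/negP; have := iE i; have := iE i'; lia.
Qed.

End Shifted.

(** * Counting cliques by their initial parts, and part (II) *)

Lemma cliques_links n r s a (H : {set {set 'I_n}}) (K Ts : {set {set 'I_n}}) :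
  a <= r <= s ->
  (forall S, S \in K -> is_clique r s H S) ->
  (forall S T : {set 'I_n}, S \in K -> T \subset S -> #|T| = s - r + a ->
     (forall x y, x \in T -> y \in S :\: T -> x < y) -> T \in Ts) ->
  #|K| <= \sum_(T in Ts) #|links r s H a T|.
Proof.
move=> /andP[ar rs] KK KT; apply: leq_card_decomp => S SK.
have cS := clique_card (KK _ SK).
have [|T [TS cT lT]] := @exists_initial _ S (s - r + a); first by rewrite cS; lia.
exists T; first exact: KT lT.
rewrite TS inE cardsDS // cS cT /=; apply/and3P; split.
- by apply/eqP; lia.
- by have := setID S T; rewrite (setIidPr TS) => ->; apply: KK.
- by apply/forall_inP => x xT; apply/forall_inP => y yS; apply: lT.
Qed.

Lemma initial_subset n (S T : {set 'I_n}) c :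
  T \subset S -> (forall x y, x \in T -> y \in S :\: T -> x < y) ->
  #|T| <= #|S :&: ini c| -> T \subset ini c.
Proof.
move=> TS lT le; apply/subsetP => x xT; rewrite inE ltnNge; apply/negP => cx.
have : #|S :&: @ini n c| < #|T|; last by rewrite ltnNge le.
apply: proper_card; apply/properP; split; last by exists x; rewrite // !inE ltnNge cx andbF.
apply/subsetP => y; rewrite !inE => /andP[yS yc]; apply: contraLR yc => yT.
by rewrite -leqNgt; apply: leq_trans cx (ltnW _); apply: lT; rewrite // inE yT.
Qed.

(** [P + 1] counts at most P initial parts of surplus cliques and one block of lost ones; the second
    summand pays for the q-sets meeting the first m + q + 1 vertices. Each takes half of 4 r^2 k
    P. *)
Lemma middle_size_bound a k r P : 0 < a -> a < r -> 0 < k -> 0 < P ->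
  2 * k * (r - a) * (P + 1) + (a * k + a - 1 + (r - a) + 1) * (r - a) <=
  4 * r ^ 2 * k * P.
Proof.
move=> a0 ar k0 P0; set w := r * r * k * P.
have -> : 4 * r ^ 2 * k * P = 2 * w + 2 * w by rewrite /w -mulnn; lia.
apply: leq_add.
  have h : k * (r - a) * (P + 1) <= k * r * (P + P) by apply: leq_mul; nia.
  have h2 : 2 * (k * r * P) <= r * (k * r * P) by apply: leq_mul => //; lia.
  by rewrite /w; lia.
have h : a * k + a - 1 + (r - a) + 1 <= 2 * (r * k).
  have : a * k + k <= r * k by rewrite -mulSnr leq_mul2r ar orbT.
  have : r <= r * k by rewrite leq_pmulr.
  lia.
have h2 : (a * k + a - 1 + (r - a) + 1) * (r - a) <= 2 * (r * k) * r by apply: leq_mul => //; lia.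
apply: leq_trans h2 _; have : r * r * k <= w by rewrite leq_pmulr.
lia.
Qed.
Lemma mulnS_le_size r k P n : 0 < P -> 0 < k -> 1 < r -> 4 * r ^ 2 * k * P <= n -> r * k.+1 <= n.
Proof.
move=> P0 k0 r1; apply: leq_trans; rewrite -mulnn.
have : r * k.+1 <= r * r * k by rewrite -mulnA leq_mul2l; apply/orP; right; nia.
have : r * r * k <= r * r * k * P by rewrite leq_pmulr.
lia.
Qed.

Section Middle.
Variables (n k r s a : nat) (H : {set {set 'I_n}}).
Hypotheses (Hs : shifted H) (noM : ~ has_matching H k.+1).
Hypotheses (rs : r <= s) (k0 : 0 < k) (a0 : 0 < a) (ar : a < r).
Hypotheses (ak : (a - 1) * k <= s - r) (sk : s - r < a * k).

Let m := a * k + a - 1.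
Let j := s - r + a.
Let q := r - a.

(** The block is the highest j-set inside the first m vertices, so its top a vertices can be shifted
    to any a-set of that segment. *)
Definition block_links : {set {set 'I_n}} :=
  [set A : {set 'I_n} | [&& #|A| == q, [disjoint A & @ini n (m + q + 1)] &
     is_clique r s H (itv (m - j) m :|: A)]].

(** The clique S forces a low edge G with only a - 1 vertices below m. Together with k completions
    of the block, each joined to a disjoint a-set below m, it would give a matching of size k +
    1. *)
Lemma block_links_no_matching (S : {set 'I_n}) :
  m + q + 1 <= n -> is_clique r s H S -> #|S :&: ini m| < j ->
  ~ has_matching block_links k.
Proof.
move=> mn KS Sm [A [AL Ad]].
have cS := clique_card KS.
have jm : j <= m by rewrite /j /m; lia.
have aj : a <= j by rewrite /j; lia.
have [|T [TS cT lT]] := @exists_initial _ S (s - r); first by rewrite cS leq_subr.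
set F := S :\: T in lT.
have cF : #|F| = r by rewrite cardsDS // cS cT; lia.
have FH : F \in H by apply: (clique_edge KS) => //; apply: subsetDl.
have Fm : #|F :&: ini m| < a.
  rewrite ltnNge; apply/negP => Fa.
  have /card_gt0P[y] : 0 < #|F :&: ini m| by apply: leq_trans Fa.
  rewrite inE => /andP[yF]; rewrite inE => ym.
  move: Sm; apply/negP; rewrite -leqNgt.
  have -> : S :&: ini m = T :|: (F :&: ini m).
    apply/setP => x; rewrite !inE; case xT: (x \in T) => //=.
    by rewrite (subsetP TS _ xT) /=; apply: ltn_trans ym; apply: lT.
  rewrite card_disjointU ?cT ?leq_add2l //.
  by apply/setP => x; rewrite !inE; case: (x \in T).
(* G is the lowest r-set with exactly a - 1 vertices below m; since F has at most a - 1 there, G is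
   an edge by shiftedness. *)
pose G : {set 'I_n} := itv 0 (a - 1) :|: itv m (m + q + 1).
have GH : G \in H.
  have m1 : a - 1 <= m by rewrite /m; lia.
  apply: (shifted_dominate Hs _ _ FH) => [|c].
    rewrite cF card_disjointU; last by apply/setP => x; rewrite !inE; lia.
    by rewrite !card_itv; move: ar; rewrite /q; lia.
  have Fc : #|F :&: ini c| <= #|F :&: ini m| + (c - m).
    have [cm|mc] := leqP c m.
      apply: leq_trans (leq_addr _ _).
      by apply/subset_leq_card/setIS/subsetP => x; rewrite !inE => /leq_trans ->.
    have [cn|nc] := leqP c n.
      rewrite -(card_itv m cn); apply: leq_trans (leq_card_setU _ _).1.
      by apply/subset_leq_card/subsetP => x; rewrite !inE; case: (x \in F) => //=; lia.
    apply: (@leq_trans (#|F :&: ini m| + #|@itv n m n|)).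
      apply: leq_trans (leq_card_setU _ _).1.
      by apply/subset_leq_card/subsetP => x; rewrite !inE ltn_ord; case: (x \in F) => //=; lia.
    by rewrite card_itv //; lia.
  have Fr : #|F :&: ini c| <= r by rewrite -cF; apply/subset_leq_card/subsetIl.
  have Fc' : #|F :&: ini c| <= c.
    by apply: leq_trans (card_ini_le n c); apply/subset_leq_card/subsetIr.
  have -> : G :&: ini c = itv 0 (minn (a - 1) c) :|: itv m (minn (m + q + 1) c).
    by apply/setP => x; rewrite !inE; lia.
  rewrite card_disjointU; last by apply/setP => x; rewrite !inE; lia.
  by rewrite !card_itv; move: Fc Fr Fm; rewrite /q; lia.
(* As m = a - 1 + a k, the k blocks of length a exactly fill what G leaves free below m. *)
pose B (i : 'I_k) : {set 'I_n} := itv (a - 1 + a * i) (a - 1 + a * i.+1).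
have mE : m = a - 1 + a * k by rewrite /m; lia.
have iE (i : 'I_k) : a * i.+1 <= a * k by rewrite leq_mul2l ltn_ord orbT.
have cB i : #|B i| = a by rewrite card_itv; have := iE i; rewrite ?mulnS; lia.
have ALP i : [/\ #|A i| = q, [disjoint A i & @ini n (m + q + 1)] &
     is_clique r s H (itv (m - j) m :|: A i)].
  by have := AL i; rewrite inE => /and3P[/eqP].
have disA (X : {set 'I_n}) i : X \subset ini (m + q + 1) -> [disjoint X & A i].
  by move=> Xs; apply: disjointWl Xs _; have [_] := ALP i; rewrite disjoint_sym.
have Bini i : B i \subset ini (m + q + 1).
  by apply/subsetP => x; rewrite !inE; have := iE i; lia.
have Gini : G \subset ini (m + q + 1).
  by apply/subsetP => x; rewrite !inE; lia.
have BH i : B i :|: A i \in H.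
  have [cA dA KA] := ALP i.
  have cB0 : #|@itv n (m - a) m| = a by rewrite card_itv; lia.
  have dB0 : [disjoint @itv n (m - a) m & A i].
    by apply: disA; apply/subsetP => x; rewrite !inE; lia.
  apply: (@shifted_dominateU _ _ (itv (m - a) m)) => //; rewrite ?cB //; first exact: disA.
    move=> c.
    have -> : itv (m - a) m :&: ini c = @itv n (m - a) (minn m c).
      by apply/setP => x; rewrite !inE; lia.
    have -> : B i :&: ini c = itv (a - 1 + a * i) (minn (a - 1 + a * i.+1) c).
      by apply/setP => x; rewrite !inE; lia.
    by rewrite !card_itv; have := iE i; rewrite ?mulnS; lia.
  apply: (clique_edge KA).
    by apply/setSU/subsetP => x; rewrite !inE; lia.
  by rewrite card_disjointU ?disjoint_setI0 // cB0 cA /q; lia.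
apply: noM; apply: (@has_matching_fin _ (option 'I_k) _
    (fun o => if o is Some i then B i :|: A i else G)).
- by rewrite card_option card_ord.
- by case.
have dG i : [disjoint B i :|: A i & G].
  rewrite disjoints_subset subUset -!disjoints_subset; apply/andP; split; last first.
    by rewrite disjoint_sym disA.
  by apply/pred0P => x /=; rewrite !inE; apply/negP; have := iE i; lia.
move=> [i|] [i'|] //= ne; [|by rewrite disjoint_sym dG].
have [_ dA _] := ALP i; have [_ dA' _] := ALP i'.
apply: (@glued_disjoint _ _ _ _ _ (m + q + 1)) => //; last first.
  by apply: Ad; apply: contra_neq ne => ->.
have {}ne : i != i' by apply: contra_neq ne => ->.
wlog lt : i i' ne {dA dA'} / i < i'.
  move=> wl; have [lt|gt|/val_inj eq] := ltngtP i i'; first exact: wl.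
    by rewrite disjoint_sym wl // eq_sym.
  by rewrite eq eqxx in ne.
have le : a * i.+1 <= a * i' by rewrite leq_mul2l lt orbT.
by apply/pred0P => x /=; rewrite !inE; apply/negP; lia.
Qed.

Lemma cliques_middle :
  4 * r ^ 2 * k * 'C(r * k + r - 1, s - r + a) <= n ->
  num_cliques r s H <= num_cliques r s (frankl n k r a).
Proof.
rewrite -/j; set P := 'C(_, _) => nP.
have jm : j <= m by rewrite /j /m; lia.
have ark : a * k <= r * k by rewrite leq_mul2r (ltnW ar) orbT.
have mr : m <= r * k + r - 1 by rewrite /m; lia.
have P0 : 0 < P by rewrite bin_gt0 (leq_trans jm mr).
have big : 2 * k * q * (P + 1) + (m + q + 1) * q <= n.
  exact: leq_trans (middle_size_bound a0 ar k0 P0) nP.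
have mn : m + q + 1 <= n.
  apply: leq_trans big; apply: leq_trans (leq_addl _ _).
  by rewrite leq_pmulr // /q subn_gt0.
have rn : r * k.+1 <= n by apply: (mulnS_le_size P0 k0 _ nP); apply: leq_ltn_trans ar.
set K := [set S | is_clique r s H S].
pose Z := [set S : {set 'I_n} | (#|S| == s) && (j <= #|S :&: ini m|)].
have Zle : #|Z| <= num_cliques r s (frankl n k r a).
  apply/subset_leq_card/subsetP => S; rewrite !inE => /andP[/eqP cS Sj].
  by apply: frankl_clique => //; rewrite (ltnW ar).
apply: leq_trans Zle; rewrite /num_cliques -/K.
have [KZ|/subsetPn[S0]] := boolP (K \subset Z); first exact: subset_leq_card.
rewrite !inE => KS0; rewrite (clique_card KS0) eqxx /= -ltnNge => S0m.
have q0n : 0 < q <= n by rewrite /q; lia.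
have noB := block_links_no_matching mn KS0 S0m.
have cL : n * #|block_links| <= 2 * k * q * 'C(n, q).
  apply: leq_trans (@card_no_matching n block_links q k.-1 q0n _ _) _.
  - by move=> A; rewrite inE => /andP[/eqP].
  - by rewrite prednK.
  by rewrite !leq_mul // leq_pred.
pose D := [set A : {set 'I_n} | A \subset ~: ini (m + q + 1) & #|A| == q].
have cD : #|D| = 'C(n - (m + q + 1), q).
  by rewrite cards_draws; congr 'C(_, _); have := cardsC (@ini n (m + q + 1)); rewrite card_ini // card_ord; lia.
have BD : block_links \subset D.
  apply/subsetP => A; rewrite !inE => /and3P[-> d _]; rewrite andbT.
  by rewrite -disjoints_subset.
pose X := [set itv (m - j) m :|: A | A in D :\: block_links].
have cT0 : #|@itv n (m - j) m| = j by rewrite card_itv; lia.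
have dT0 A : A \in D -> @itv n (m - j) m :&: A = set0.
  rewrite inE -disjoints_subset => /andP[d _]; apply: disjoint_setI0.
  rewrite disjoint_sym; apply: disjointWr d.
  by apply/subsetP => x; rewrite !inE; lia.
have cX : #|X| = 'C(n - (m + q + 1), q) - #|block_links|.
  rewrite card_in_imset ?cardsDS ?cD // => A A' /setDP[AD _] /setDP[A'D _] /setP eq.
  apply/setP => x; have := eq x; have /setP/(_ x) := dT0 _ AD; have /setP/(_ x) := dT0 _ A'D.
  by rewrite !inE; case: (_ <= _ < _) => //= -> ->.
have XZ : X \subset Z.
  apply/subsetP => _ /imsetP[A /setDP[AD _] ->]; rewrite inE.
  rewrite card_disjointU ?dT0 // cT0; apply/andP; split.
    by move: AD; rewrite inE => /andP[_ /eqP ->]; rewrite /j /q; apply/eqP; lia.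
  rewrite -cT0; apply/subset_leq_card/subsetP => x; rewrite !inE; lia.
have KX : [disjoint K & X].
  apply/pred0P => S /=; apply/negP => /andP[SK /imsetP[A /setDP[AD AB] eS]].
  move/negP: AB; apply; move: AD SK; rewrite eS !inE -disjoints_subset.
  by case/andP=> -> -> ->.
(* A surplus clique has its first j vertices below r k + r - 1 by [clique_initial], but not all
   below m. *)
pose Ts := [set T : {set 'I_n} | T \subset ini (r * k + r - 1) & #|T| == j]
   :\: [set T : {set 'I_n} | T \subset ini m].
have cTs : #|Ts| <= P.
  apply: leq_trans (subset_leq_card (subsetDl _ _)) _; rewrite cards_draws card_ini //; lia.
have K1 : #|K :\: Z| <= \sum_(T in Ts) #|links r s H a T|.
  apply: cliques_links; first by rewrite (ltnW ar).
    by move=> S; rewrite !inE => /andP[].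
  move=> S T; rewrite !inE => /andP[nZ KS] TS cT lT.
  move: nZ; rewrite (clique_card KS) eqxx /= -ltnNge => Sm.
  apply/andP; split.
    apply/negP => Tm; move: Sm; apply/negP; rewrite -leqNgt /j -cT.
    by apply/subset_leq_card; rewrite subsetI TS.
  rewrite cT eqxx andbT; apply: (initial_subset TS lT); rewrite cT.
  by apply: (clique_initial Hs noM) => //; rewrite a0 (ltnW ar).
have nK1 : n * #|K :\: Z| <= P * (2 * k * q * 'C(n, q)).
  apply: (leq_trans (leq_mul (leqnn n) K1)); rewrite big_distrr /=.
  apply: (@leq_trans (\sum_(T in Ts) 2 * k * q * 'C(n, q))); last first.
    by rewrite sum_nat_const leq_mul2r cTs orbT.
  apply: leq_sum => T; rewrite !inE => /and3P[Tm _ /eqP cT].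
  apply: card_no_matching => //; first by move=> A; case/linksP.
  apply: (links_no_matching Hs noM rs) => //; first by rewrite a0 (ltnW ar).
  by rewrite mulnS; move: mn; rewrite /m; lia.
have K0 : #|K :&: Z| <= #|Z| - #|X|.
  rewrite -cardsDS //; apply/subset_leq_card/subsetP => S; rewrite !inE.
  by case/andP=> KS ->; rewrite andbT (disjointFr KX) // inE.
have XZc := subset_leq_card XZ.
(* The surplus is at most the size of X. Multiplied by n, every term is compared with a multiple of
   C(n, q), and [big] closes the estimate. *)
have key : #|K :\: Z| + #|block_links| <= 'C(n - (m + q + 1), q).
  have n0 : 0 < n by lia.
  rewrite -(leq_pmul2l n0) mulnDr.
  have := @bin_sub_le n (m + q + 1) q; case/andP: q0n => -> _ /(_ isT mn).
  have := leq_mul big (leqnn 'C(n, q)); rewrite mulnDl mulnDr muln1 mulnDl.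
  move: nK1 cL; rewrite [P * _]mulnC -!mulnA ['C(n, q) * P]mulnC; lia.
rewrite -(cardsID Z K); apply: (leq_trans (leq_add K0 (leqnn _))).
rewrite -[leqRHS](subnK XZc) leq_add2l cX leq_subRL; last first.
  exact: leq_trans (leq_addl _ _) key.
by rewrite addnC.
Qed.

End Middle.

(** * Part (I) *)

Lemma compress_matching n r x c0 (H : {set {set 'I_n}}) :
  shifted H -> is_rgraph r H ->
  has_matching [set e in H | [disjoint e & @ini n c0]] x ->
  exists E : 'I_x -> {set 'I_n}, [/\ forall i, E i \in H,
    forall i i', i != i' -> [disjoint E i & E i'] &
    forall i, E i \subset itv c0 (c0 + r * x)].
Proof.
move=> Hs Hr [A [AH Ad]].
have AHi i : A i \in H by have := AH i; rewrite inE => /andP[].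
pose W := \bigcup_i A i.
have cW : #|W| = r * x.
  pose M : {ffun 'I_x -> {set 'I_n}} := finfun A.
  have Mm : matchf H M by apply/matchfP; split=> [i|i i']; rewrite !ffunE //; apply: Ad.
  rewrite -(card_verts Hr Mm); congr #|pred_of_set _|.
  by apply: eq_bigr => i _; rewrite ffunE.
have Wc w : w \in W -> c0 <= w.
  case/bigcupP=> i _ wi; have := AH i; rewrite inE => /andP[_ d].
  by have := disjointFr d wi; rewrite inE => /negbT; rewrite -leqNgt.
have rank_le w : w \in W -> c0 + #|W :&: ini w| <= w.
  move=> wW; rewrite -leq_subRL ?Wc // -(card_itv c0 (ltnW (ltn_ord w))).
  by apply/subset_leq_card/subsetP => y; rewrite !inE => /andP[/Wc -> ->].
(* Order-preserving compression of W onto consecutive vertices from c0 on. It moves no vertex of W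
   upwards, so edges stay edges; the default of [insubd] never occurs on W. *)
pose phi (w : 'I_n) : 'I_n := insubd w (c0 + #|W :&: ini w|).
have phiE w : w \in W -> phi w = c0 + #|W :&: ini w| :> nat.
  by move=> wW; rewrite val_insubd (leq_ltn_trans (rank_le w wW)).
have phi_lt w w' : w \in W -> w' \in W -> w < w' -> phi w < phi w'.
  move=> wW w'W lt; rewrite !phiE // ltn_add2l; apply: proper_card.
  apply/properP; split; last by exists w; rewrite !inE ?wW ?ltnn.
  by apply/setIS/subsetP => y; rewrite !inE => /ltn_trans; apply.
have phi_inj : {in W &, injective phi}.
  move=> w w' wW w'W e; apply: val_inj; have [lt|lt|//] := ltngtP w w'.
    by have := phi_lt _ _ wW w'W lt; rewrite e ltnn.
  by have := phi_lt _ _ w'W wW lt; rewrite e ltnn.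
have AW i : A i \subset W by apply: bigcup_sup.
exists (fun i => phi @: A i); split=> [i|i i' ii'|i].
- have inji : {in A i &, injective phi}.
    by apply: sub_in2 phi_inj; apply/subsetP.
  apply: (shifted_dominate Hs _ _ (AHi i)) => [|c]; first by rewrite card_in_imset.
  rewrite -(card_in_imset (f := phi) (D := A i :&: ini c)); last first.
    by apply: sub_in2 inji => y; rewrite inE => /andP[].
  apply/subset_leq_card/subsetP => _ /imsetP[w + ->]; rewrite inE => /andP[wi].
  rewrite !inE => wc; rewrite imset_f //=; apply: leq_ltn_trans wc.
  have wW := subsetP (AW i) _ wi; by rewrite phiE ?rank_le.
- apply/pred0P => y /=; apply/negP => /andP[/imsetP[w wi ->] /imsetP[w' w'i']].
  move/(phi_inj _ _ (subsetP (AW i) _ wi) (subsetP (AW i') _ w'i')) => ww'.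
  by have := disjointFr (Ad _ _ ii') wi; rewrite ww' w'i'.
- apply/subsetP => _ /imsetP[w wi ->]; have wW := subsetP (AW i) _ wi.
  rewrite inE phiE // leq_addr ltn_add2l -cW; apply: proper_card.
  by apply/properP; split; [exact: subsetIl|exists w; rewrite // !inE ltnn andbF].
Qed.

(** Half of Q n pays for the P term through the binomial hypothesis, the other half for the Q terms
    through 16 r^2 k <= n. *)
Lemma bottom_size_bound k r u P Q n : 0 < k -> 1 < r -> u < k -> 16 * r ^ 2 * k <= n ->
  4 * r * k * P <= n * Q ->
  Q * (2 * k * (r - 1) + (u + r * (k - u) + 1) * (r - 1)) + P * (2 * k * (r - 1))
    + Q * (k * (r - 1)) <= Q * n.
Proof.
move=> k0 r1 uk nr PQ.
have h1 : 2 * (P * (2 * k * (r - 1))) <= Q * n.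
  rewrite [Q * n]mulnC; apply: leq_trans PQ.
  have : (r - 1) * (4 * k * P) <= r * (4 * k * P) by rewrite leq_mul2r leq_subr orbT.
  lia.
have h2 : 2 * (2 * k * (r - 1) + (u + r * (k - u) + 1) * (r - 1) + k * (r - 1)) <= n.
  apply: leq_trans nr; rewrite -mulnn.
  have N : u + r * (k - u) + 1 <= r * k + 1.
    have : u * 1 <= u * r by rewrite leq_mul2l ltnW ?orbT.
    rewrite mulnBr; have : r * u <= r * k by rewrite leq_mul2l ltnW ?orbT.
    lia.
  have : (u + r * (k - u) + 1) * (r - 1) <= (r * k + 1) * r by apply: leq_mul => //; lia.
  have : k * (r - 1) <= k * r by rewrite leq_mul2l leq_subr orbT.
  have : k * r * 1 <= k * r * r by rewrite leq_mul2l ltnW ?orbT.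
  have : r * 1 <= r * k by rewrite leq_mul2l k0 orbT.
  lia.
have := leq_mul (leqnn Q) h2; lia.
Qed.

Section Bottom.
Variables (n k r s : nat) (H : {set {set 'I_n}}).
Hypotheses (Hs : shifted H) (Hr : is_rgraph r H) (noM : ~ has_matching H k.+1).
Hypotheses (rs : r <= s) (k0 : 0 < k) (r1 : 1 < r) (sk : s - r < k).
Hypothesis nr : 16 * r ^ 2 * k <= n.

Let q := r - 1.
Let j := s - r + 1.

(** The vertex v >= u of T can be shifted to each of the u + 1 vertices 0, ..., u. With u + 1
    disjoint far completions and the k - u edges E, which start at u + 1, this makes k + 1 disjoint
    edges. *)
Lemma links_far_no_matching u (T : {set 'I_n}) (E : 'I_(k - u) -> {set 'I_n}) :
  u < k -> k <= n -> (forall i, E i \in H) -> (forall i i', i != i' -> [disjoint E i & E i']) ->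
  (forall i, E i \subset itv u.+1 (u.+1 + r * (k - u))) ->
  ~~ (T \subset ini u) ->
  ~ has_matching [set A in links r s H 1 T |
      [disjoint A & @ini n (u + r * (k - u) + 1)]] u.+1.
Proof.
move=> uk kn EH Ed Esub /subsetPn[v vT]; rewrite inE -leqNgt => uv [A [AL Ad]].
have ALP i : A i \in links r s H 1 T /\ [disjoint A i & @ini n (u + r * (k - u) + 1)].
  by have := AL i; rewrite inE => /andP[].
have pf (i : 'I_u.+1) : i < n by have := ltn_ord i; lia.
pose B (i : 'I_u.+1) : {set 'I_n} := [set Ordinal (pf i)].
have Bini i : B i \subset ini (u + r * (k - u) + 1).
  by apply/subsetP => x; rewrite !inE => /eqP -> /=; rewrite addn1 ltnS (leq_trans _ (leq_addr _ _)) // -ltnS ltn_ord.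
have Eini i : E i \subset ini (u + r * (k - u) + 1).
  by apply: subset_trans (Esub i) _; apply/subsetP => x; rewrite !inE; lia.
have dAX (X : {set 'I_n}) i : X \subset ini (u + r * (k - u) + 1) -> [disjoint X & A i].
  by move=> Xs; apply: disjointWl Xs _; have [_] := ALP i; rewrite disjoint_sym.
have BH i : B i :|: A i \in H.
  have [/linksP[cA KA lA] dA] := ALP i.
  have vA : [disjoint [set v] & A i].
    by rewrite disjoints1; apply/negP => vA; have := lA _ _ vT vA; rewrite ltnn.
  apply: (@shifted_dominateU _ _ [set v]) => //; rewrite ?cards1 //; first exact: dAX.
    move=> c; have [cv|vc] := leqP c v.
      rewrite (_ : [set v] :&: ini c = set0) ?cards0 //.
      by apply/setP => x; rewrite !inE; apply/negP => /andP[/eqP ->]; lia.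
    apply: leq_trans (subset_leq_card (subsetIl _ _)) _; rewrite cards1.
    apply/card_gt0P; exists (Ordinal (pf i)); rewrite !inE eqxx /=.
    by have := ltn_ord i; lia.
  apply: (clique_edge KA); first by rewrite setSU ?sub1set.
  by rewrite card_disjointU ?disjoint_setI0 // cards1 cA; lia.
apply: noM; apply: (@has_matching_fin _ ('I_u.+1 + 'I_(k - u))%type _
    (fun o => match o with inl i => B i :|: A i | inr i => E i end)).
- by rewrite card_sum !card_ord; lia.
- by case.
have dBE i i' : [disjoint B i :|: A i & E i'].
  rewrite disjoints_subset subUset -!disjoints_subset; apply/andP; split; last first.
    by rewrite disjoint_sym dAX.
  rewrite disjoints1; apply/negP => /(subsetP (Esub i')); rewrite inE /=.
  by have := ltn_ord i; lia.
move=> [i|i] [i'|i'] ne.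
- have {}ne : i != i' by apply: contra_neq ne => ->.
  have [_ d] := ALP i; have [_ d'] := ALP i'.
  apply: (@glued_disjoint _ _ _ _ _ (u + r * (k - u) + 1)) => //; last exact: Ad.
  by rewrite disjoints1 inE; apply: contra_neq ne => /(congr1 val) /= /val_inj.
- exact: dBE.
- by rewrite disjoint_sym.
- by apply: Ed; apply: contra_neq ne => ->.
Qed.

Lemma cliques_bottom :
  (forall u, u < k -> 4 * r * k * ('C(u + r * (k - u) + 1, j) - 'C(u, j)) <=
     n * ('C(k, j) - 'C(u, j))) ->
  num_cliques r s H <= num_cliques r s (frankl n k r 1).
Proof.
move=> hbin.
have kn : r * k.+1 <= n.
  apply: (@mulnS_le_size r k 1) => //; apply: leq_trans nr.
  by rewrite muln1 !leq_mul.
have kn' : k <= n by apply: leq_trans kn; rewrite (leq_trans (leqnSn k)) ?leq_pmull // ltnW.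
set K := [set S | is_clique r s H S].
pose Z c := [set S : {set 'I_n} | (#|S| == s) && (j <= #|S :&: ini c|)].
have Zle : #|Z k| <= num_cliques r s (frankl n k r 1).
  apply/subset_leq_card/subsetP => S; rewrite !inE => /andP[/eqP cS Sj].
  by apply: frankl_clique => //; rewrite ?mul1n ?addnK // ltnW.
apply: leq_trans Zle; rewrite /num_cliques -/K.
pose Hu u := [set e in H | [disjoint e & @ini n u]].
(* 0 is good by [noM]. For the largest good u < k, failure at u + 1 yields k - u disjoint edges
   avoiding the first u + 1 vertices. *)
pose good u := (u <= k) && ~~ [exists M : {ffun 'I_(k - u).+1 -> {set 'I_n}}, matchf (Hu u) M].
have ex : exists u, good u.
  exists 0; rewrite /good /= subn0; apply/has_matchingP => hm; apply: noM.
  by apply: has_matching_sub hm; apply/subsetP => e; rewrite inE => /andP[].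
have ub u : good u -> u <= k by case/andP.
case: (ex_maxnP ex ub) => u /andP[uk noMu] umax.
have {}noMu : ~ has_matching (Hu u) (k - u).+1 by move/has_matchingP; rewrite (negPf noMu).
have outside (S : {set 'I_n}) c : is_clique r s H S -> #|S :&: ini c| < j ->
    exists2 e, e \in H & [disjoint e & @ini n c].
  move=> KS Sc; have [|e eS ce] := @exists_subset_card _ (S :\: ini c) r.
    by have := cardsID (ini c) S; rewrite (clique_card KS); move: Sc; rewrite /j; lia.
  exists e; first by apply: (clique_edge KS) => //; apply: subset_trans eS (subsetDl _ _).
  by rewrite disjoints_subset; apply: subset_trans eS _; rewrite setDE subsetIr.
move: uk; rewrite leq_eqVlt => /orP[/eqP uk|uk].
  (* For u = k every edge meets the first k vertices, so every clique is already in Z k. *)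
  apply/subset_leq_card/subsetP => S; rewrite !inE => KS.
  rewrite (clique_card KS) eqxx /= leqNgt; apply/negP => /(outside _ _ KS)[e eH de].
  apply: noMu; rewrite uk subnn; exists (fun=> e); split=> [_|i i']; last by rewrite !ord1.
  by rewrite inE eH.
have [E [EH Ed Esub]] : exists E : 'I_(k - u) -> {set 'I_n}, [/\ forall i, E i \in H,
    forall i i', i != i' -> [disjoint E i & E i'] &
    forall i, E i \subset itv u.+1 (u.+1 + r * (k - u))].
  apply: compress_matching => //.
  have : ~~ good u.+1 by apply/negP => /umax; rewrite ltnn.
  rewrite /good uk /= negbK => /has_matchingP; apply: has_matching_leq; lia.
set N := u + r * (k - u) + 1.
have Nn : N <= n.
  apply: leq_trans kn; rewrite /N mulnS.
  have : u * 1 <= u * r by rewrite leq_mul2l ltnW ?orbT.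
  rewrite mulnBr; have : r * u <= r * k by rewrite leq_mul2l ltnW ?orbT.
  lia.
have uN : u < N by rewrite /N addn1 ltnS leq_addr.
have NE : u.+1 + r * (k - u) = N by rewrite /N addn1.
(* Otherwise the clique contains an edge beyond N, which extends E to k - u + 1 disjoint edges
   avoiding the first u vertices. *)
have KN S : is_clique r s H S -> j <= #|S :&: ini N|.
  move=> KS; rewrite leqNgt; apply/negP => /(outside _ _ KS)[e eH de].
  apply: noMu; apply: (@has_matching_fin _ (option 'I_(k - u)) _
    (fun o => if o is Some i then E i else e)).
  - by rewrite card_option card_ord.
  - case=> [i|]; rewrite inE ?EH ?eH /=.
      apply/pred0P => x /=; apply/negP => /andP[/(subsetP (Esub i))]; rewrite !inE; lia.
    by apply: disjointWr de; apply/subsetP => x; rewrite !inE => /ltn_trans; apply.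
  have dE i : [disjoint E i & e].
    apply: disjointWl (Esub i) _; rewrite disjoint_sym; apply: disjointWr de.
    by apply/subsetP => x; rewrite !inE NE => /andP[].
  move=> [i|] [i'|] // ne; first by apply: Ed; apply: contra_neq ne => ->.
  by rewrite disjoint_sym.
have q0n : 0 < q <= n by rewrite /q; move: kn r1; rewrite mulnS; lia.
have jk : j <= k by rewrite /j; lia.
pose Dr c := [set T : {set 'I_n} | T \subset ini c & #|T| == j].
have cDr c : c <= n -> #|Dr c| = 'C(c, j) by move=> cn; rewrite cards_draws card_ini.
have DrS c c' : c <= c' -> Dr c \subset Dr c'.
  move=> cc'; apply/subsetP => T; rewrite !inE => /andP[/subset_trans -> //].
  by apply/subsetP => x; rewrite !inE => /leq_trans ->.
have un : u <= n by apply: leq_trans (ltnW uN) Nn.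
(* A T in [T1] is also available to Z k but has few completions in H; the T in [T2] are the surplus,
   controlled through P. *)
pose T1 := Dr k :\: Dr u; pose T2 := (Dr N :\: Dr u) :\: Dr k.
have cT1 : #|T1| = 'C(k, j) - 'C(u, j).
  by rewrite cardsDS ?DrS 1?ltnW // !cDr //; lia.
have cT2 : #|T2| <= 'C(N, j) - 'C(u, j).
  apply: leq_trans (subset_leq_card (subsetDl _ _)) _.
  by rewrite (cardsDS (DrS _ _ (ltnW uN))) !cDr.
set Q := 'C(k, j) - 'C(u, j) in cT1; set P := 'C(N, j) - 'C(u, j) in cT2.
have K1 : #|K :\: Z u| <= \sum_(T in T1 :|: T2) #|links r s H 1 T|.
  apply: cliques_links; first by rewrite ltnW.
    by move=> S; rewrite !inE => /andP[].
  move=> S T; rewrite !inE => /andP[nZ KS] TS cT lT.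
  move: nZ; rewrite (clique_card KS) eqxx /= -ltnNge => Sm.
  rewrite cT eqxx !andbT.
  have -> : T \subset ini N by apply: (initial_subset TS lT); rewrite cT; apply: KN.
  have -> : ~~ (T \subset ini u).
    apply/negP => Tm; move: Sm; apply/negP; rewrite -leqNgt /j -cT.
    by apply/subset_leq_card; rewrite subsetI TS.
  by rewrite /= andbT orbN.
have L2 T : T \in T2 -> n * #|links r s H 1 T| <= 2 * k * q * 'C(n, q).
  rewrite !inE => /and3P[Tk _ /andP[_ /eqP cT]].
  move: Tk; rewrite cT eqxx andbT => Tk.
  apply: card_no_matching => //; first by move=> A; case/linksP.
  apply: (links_no_matching Hs noM rs); rewrite ?mul1n ?subnn ?mul0n ?addnK //.
    by rewrite (ltnW r1).
  by apply: leq_trans kn; rewrite leq_pmull // ltnW.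
have L1 T : T \in T1 -> n * #|links r s H 1 T| <= (2 * k * q + N * q) * 'C(n, q).
  rewrite !inE => /andP[Tu /andP[_ /eqP cT]]; move: Tu; rewrite cT eqxx andbT => Tu.
  have far := @links_far_no_matching u T E uk kn' EH Ed Esub Tu.
  set Lf := [set A in _ | _] in far.
  pose D := [set A : {set 'I_n} | #|A| == q].
  pose D' := [set A : {set 'I_n} | A \subset ~: ini N & #|A| == q].
  (* Completions meeting the first N vertices are few in any case; the others are handled by
     [far]. *)
  have sub : links r s H 1 T \subset Lf :|: (D :\: D').
    apply/subsetP => A AL; have [cA _ _] := linksP AL.
    rewrite in_setU in_setD [A \in Lf]inE AL [A \in D]inE [A \in D']inE cA eqxx /= !andbT.
    by rewrite disjoints_subset orbN.
  have cLf : n * #|Lf| <= 2 * k * q * 'C(n, q).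
    apply: leq_trans (@card_no_matching n Lf q u q0n _ far) _.
      by move=> A; rewrite inE => /andP[/linksP[]].
    by rewrite !leq_mul // ltnW.
  have cD : #|D| = 'C(n, q).
    rewrite -[n in 'C(n, q)]card_ord -cardsT -cards_draws.
    by apply: eq_card => A; rewrite !inE subsetT.
  have cD' : #|D'| = 'C(n - N, q).
    rewrite cards_draws; congr 'C(_, _); have := cardsC (@ini n N).
    by rewrite card_ini // card_ord; lia.
  have DD' : D' \subset D by apply/subsetP => A; rewrite !inE => /andP[].
  have cDD : n * #|D :\: D'| <= N * q * 'C(n, q).
    rewrite cardsDS // cD cD' mulnBr leq_subLR; apply: bin_sub_le => //.
    by case/andP: q0n.
  rewrite mulnDl; apply: leq_trans (leq_add cLf cDD); rewrite -mulnDr leq_mul2l.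
  by rewrite (leq_trans (subset_leq_card sub) (leq_card_setU _ _).1) orbT.
have nK1 : n * #|K :\: Z u| <=
    Q * ((2 * k * q + N * q) * 'C(n, q)) + P * (2 * k * q * 'C(n, q)).
  apply: (leq_trans (leq_mul (leqnn n) K1)); rewrite big_distrr /=.
  rewrite (eq_bigl [predU T1 & T2]) => [|T]; last by rewrite !inE.
  rewrite bigU /=; last first.
    rewrite disjoints_subset; apply/subsetP => T; rewrite in_setC !in_setD.
    by case/andP=> _ ->.
  apply: leq_add; [rewrite -cT1|apply: (@leq_trans (#|T2| * (2 * k * q * 'C(n, q))))].
  - by rewrite -sum_nat_const; apply: leq_sum.
  - by rewrite -sum_nat_const; apply: leq_sum.
  - by rewrite leq_mul2r cT2 orbT.
pose Da := [set A : {set 'I_n} | A \subset ~: ini k & #|A| == q].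
have cDa : #|Da| = 'C(n - k, q).
  rewrite cards_draws; congr 'C(_, _); have := cardsC (@ini n k).
  by rewrite card_ini // card_ord; lia.
(* Intersecting with the first k vertices recovers T and A from their union, so X has Q C(n - k, q)
   members, all in Z k but not in Z u. *)
pose X := (fun c : {set 'I_n} * {set 'I_n} => c.1 :|: c.2) @: setX T1 Da.
have TAk T A : T \in T1 -> A \in Da ->
    (T :|: A) :&: ini k = T /\ (T :|: A) :\: ini k = A.
  rewrite !inE => /andP[_ /andP[/subsetP Tk _]] /andP[/subsetP Ak _].
  have Tk' x : x \in T -> x < k by move/Tk; rewrite inE.
  have Ak' x : x \in A -> (x < k) = false by move/Ak; rewrite !inE => /negPf.
  split; apply/setP => x; rewrite !inE.
    case xT: (x \in T); first by rewrite Tk'.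
    by case xA: (x \in A); rewrite //= Ak'.
  case xA: (x \in A); first by rewrite Ak' // orbT.
  by case xT: (x \in T); rewrite ?andbF // Tk'.
have cX : #|X| = Q * 'C(n - k, q).
  rewrite card_in_imset ?cardsX ?cT1 ?cDa // => -[T A] [T' A'] /=.
  rewrite !in_setX /= => /andP[h1 h2] /andP[h3 h4] e.
  have [e1 e2] := TAk _ _ h1 h2; have [e3 e4] := TAk _ _ h3 h4.
  by congr (_, _); [rewrite -e1 e e3 | rewrite -e2 e e4].
have XZ : X \subset Z k :\: Z u.
  apply/subsetP => _ /imsetP[[T A] + ->]; rewrite in_setX /= => /andP[TT AD].
  have [e1 e2] := TAk _ _ TT AD; move: (TT) AD; rewrite [T \in T1]inE [A \in Da]inE.
  rewrite !inE => /andP[Tu /andP[Tk /eqP cT]] /andP[Ak /eqP cA].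
  have cTA : #|T :|: A| = s by rewrite -(cardsID (ini k)) e1 e2 cT cA /j /q; lia.
  rewrite cTA e1 cT eqxx leqnn /= andbT -ltnNge.
  move: Tu; rewrite cT eqxx andbT => Tu; rewrite -cT; apply: proper_card.
  have -> : (T :|: A) :&: ini u = T :&: ini u.
    rewrite -[in RHS]e1 -setIA; congr (_ :&: _); apply/esym/setIidPr.
    by apply/subsetP => x; rewrite !inE => /ltn_trans; apply.
  by rewrite properE subsetIl subsetI subxx.
have ZZ : Z u \subset Z k.
  apply/subsetP => S; rewrite !inE => /andP[-> /leq_trans]; apply.
  by apply/subset_leq_card/setIS/subsetP => x; rewrite !inE => /ltn_trans; apply.
have key : #|K :\: Z u| <= Q * 'C(n - k, q).
  have n0 : 0 < n by apply: leq_trans kn'.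
  rewrite -(leq_pmul2l n0).
  have q0 : 0 < q by case/andP: q0n.
  have A1 := @bin_sub_le n k q q0 kn'.
  have A2 := leq_mul (bottom_size_bound k0 r1 uk nr (hbin u uk)) (leqnn 'C(n, q)).
  have A3 := leq_mul (leqnn Q) A1.
  rewrite -/q -/N -/P -/Q in A2.
  move: nK1 A2 A3; rewrite !mulnDl !mulnDr; lia.
rewrite -(cardsID (Z u) K) -(cardsID (Z u) (Z k)) (setIidPr ZZ); apply: leq_add.
  by apply: subset_leq_card; apply: subsetIr.
by apply: leq_trans key _; rewrite -cX; apply: subset_leq_card.
Qed.

End Bottom.

(** * Binomial estimates *)

Lemma bin_fact_le N j : 'C(N, j) * j`! <= N ^ j.
Proof.
rewrite bin_ffact; elim: j N => [|j IHj] N; first by rewrite ffactn0.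
case: N => [|N]; first by rewrite ffact0n.
rewrite ffactnS expnS leq_mul2l /=; apply: leq_trans (IHj _) _.
by case: (j) => // j'; rewrite leq_exp2r ?leqnSn.
Qed.

(** The induction step comes down to (k + 1) j <= (j + 1) k, that is j <= k. *)
Lemma expn_le_bin k j : j <= k -> k ^ j <= 'C(k, j) * j ^ j.
Proof.
elim: j k => [|j IHj] [|k] // jk.
have p0 : 0 < j ^ j by rewrite expn_gt0; case: (j).
rewrite -(leq_pmul2r p0) expnS -mulnA -expnMn.
have -> : 'C(k.+1, j.+1) * j.+1 ^ j.+1 * j ^ j =
    k.+1 * (j.+1 ^ j * ('C(k, j) * j ^ j)).
  have mb : k.+1 * 'C(k, j) = j.+1 * 'C(k.+1, j.+1) := mul_bin_diag k.+1 j.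
  rewrite expnS; transitivity ((j.+1 * 'C(k.+1, j.+1)) * (j.+1 ^ j * j ^ j)); first lia.
  by rewrite -mb; lia.
rewrite leq_mul2l /=; apply: (@leq_trans (j.+1 ^ j * k ^ j)); last first.
  by rewrite leq_mul2l IHj ?orbT.
rewrite -expnMn; case: (j) jk => // j' jk; rewrite leq_exp2r //; lia.
Qed.

Lemma binS_le2 M j : 2 * j <= M.+1 -> 'C(M.+1, j) <= 2 * 'C(M, j).
Proof.
case: j => [|j] jM; first by rewrite !bin0.
rewrite binS mul2n -addnn leq_add2l -(leq_pmul2l (ltn0Sn j)) mul_bin_left.
by rewrite leq_mul2r; apply/orP; right; lia.
Qed.

Lemma bin_addl_le N r j : 'C(N + r, j.+1) <= 'C(N, j.+1) + r * 'C(N + r.-1, j).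
Proof.
elim: r => [|r IHr]; first by rewrite addn0 mul0n addn0.
rewrite addnS binS; apply: (leq_trans (leq_add IHr (leqnn _))).
rewrite -addnA leq_add2l mulSn addnC leq_add2l leq_mul2l.
by rewrite leq_bin2l ?orbT //= leq_add2l leq_pred.
Qed.

Import Order.TTheory GRing.Theory Num.Theory.
Local Open Scope ring_scope.

Section RealBounds.
Variable R : realType.
Local Notation e := (expR 1 : R).

Lemma expR1_ge2 : 2 <= e.
Proof. by have := expR_ge1Dx (1 : R); lra. Qed.

(** A weak form of Stirling's bound: the step (j + 1)^j <= e j^j follows from 1 + 1/j <= exp
    (1/j). *)
Lemma expn_le_fact j : (j%:R : R) ^+ j <= e ^+ j * j`!%:R.
Proof.
elim: j => [|j IHj]; first by rewrite !expr0 fact0 mulr1.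
have step : (j.+1%:R : R) ^+ j <= e * j%:R ^+ j.
  case: j {IHj} => [|j]; first by rewrite !expr0 mulr1; have := expR1_ge2; lra.
  have j0 : (0 : R) < j.+1%:R by rewrite ltr0n.
  have h : (j.+2%:R : R) <= expR (j.+1%:R^-1) * j.+1%:R.
    have := expR_ge1Dx ((j.+1%:R : R)^-1); rewrite -(ler_pM2r j0).
    by rewrite mulrDl mul1r mulVf ?gt_eqF // natr1.
  have h0 : (0 : R) <= j.+2%:R by [].
  have := lerXn2r j.+1 h0 (le_trans h0 h) h.
  by rewrite exprMn -expRM_natl mulfV ?gt_eqF.
rewrite exprS factS natrM exprS.
have -> : e * e ^+ j * (j.+1%:R * j`!%:R) = j.+1%:R * (e * (e ^+ j * j`!%:R)) by ring.
rewrite ler_wpM2l //; apply: (le_trans step).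
by rewrite ler_wpM2l // expR_ge0.
Qed.

Lemma bin_mul_expn_le N j : 'C(N, j)%:R * (j%:R : R) ^+ j <= (e * N%:R) ^+ j.
Proof.
apply: (@le_trans _ _ ('C(N, j)%:R * (e ^+ j * j`!%:R))).
  by rewrite ler_wpM2l // expn_le_fact.
rewrite exprMn mulrCA ler_wpM2l ?exprn_ge0 ?expR_ge0 //.
by rewrite -natrM -natrX ler_nat bin_fact_le.
Qed.

Lemma bin_le_ratio N j x y : (N <= x)%N -> (0 < y)%N -> (y <= j)%N ->
  'C(N, j)%:R <= (e * x%:R / y%:R) ^+ j :> R.
Proof.
move=> Nx y0 yj; have y0R : (0 : R) < y%:R by rewrite ltr0n.
rewrite expr_div_n ler_pdivlMr ?exprn_gt0 //.
apply: (@le_trans _ _ ('C(N, j)%:R * (j%:R : R) ^+ j)).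
  by rewrite ler_wpM2l // lerXn2r ?nnegrE ?ler0n ?ler_nat.
apply: (le_trans (bin_mul_expn_le N j)).
by rewrite lerXn2r ?nnegrE ?mulr_ge0 ?expR_ge0 // ler_wpM2l ?expR_ge0 // ler_nat.
Qed.

Lemma bin_mull_le r k j : (j <= k)%N ->
  'C(r * k, j)%:R <= (e * r%:R) ^+ j * 'C(k, j)%:R :> R.
Proof.
move=> jk; have j0 : (0 : R) < j%:R ^+ j.
  by rewrite -natrX ltr0n expn_gt0; case: (j).
rewrite -(ler_pM2r j0); apply: (le_trans (bin_mul_expn_le _ _)).
rewrite natrM mulrA exprMn -mulrA ler_wpM2l ?exprn_ge0 ?mulr_ge0 ?expR_ge0 //.
by rewrite -!natrX -natrM ler_nat expn_le_bin.
Qed.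

Lemma bin_mullS_le r k j : (1 < r)%N -> (j <= k)%N ->
  'C(r * k + 1, j)%:R <= 2 * (e * r%:R) ^+ j * 'C(k, j)%:R :> R.
Proof.
move=> r1 jk; apply: (@le_trans _ _ (2 * 'C(r * k, j)%:R)).
  rewrite -natrM ler_nat addn1 binS_le2 //.
  by apply: leq_trans (leqnSn _); apply: leq_mul.
by rewrite -mulrA ler_wpM2l // bin_mull_le.
Qed.

(** For u < j the subtracted terms vanish. Otherwise both sides are compared as k - u grows by one;
    the base term C(u + 1, j) is at most C(k, j), which accounts for the factor 2. *)
Lemma bin_diff_le r k u j : (1 < r)%N -> (u < k)%N -> (0 < j <= k)%N ->
  ('C(u + r * (k - u) + 1, j) - 'C(u, j))%N%:R <=
    2 * (e * r%:R) ^+ j * ('C(k, j) - 'C(u, j))%N%:R :> R.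
Proof.
move=> r1 uk /andP[j0 jk].
have [uj|ju] := ltnP u j.
  rewrite (bin_small uj) !subn0; apply: (le_trans _ (bin_mullS_le r1 jk)).
  rewrite ler_nat leq_bin2l // leq_add2r -[in leqRHS](subnKC (ltnW uk)) mulnDr leq_add2r.
  by rewrite leq_pmull // ltnW.
have e2 := expR1_ge2; have r1R : (1 : R) <= r%:R by rewrite ler1n ltnW.
have er1 : 1 <= e * r%:R.
  have : e * 1 <= e * r%:R by rewrite ler_wpM2l ?expR_ge0.
  lra.
have u0 : (0 < u)%N := leq_trans j0 ju.
set Y := (e * r%:R) ^+ j; have Y1 : 1 <= Y by apply: exprn_ege1.
have mono x : ('C(u, j) <= 'C(u + x, j))%N by rewrite leq_bin2l // leq_addr.
(* One step in x adds at most Y times the increment of C(u + x, j): the factor 2 r coming from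
   [bin_mullS_le] is at most e r. *)
have ind x : 'C(u + r * x + 1, j)%:R <= 'C(u + 1, j)%:R + Y * ('C(u + x, j)%:R - 'C(u, j)%:R) :> R.
  elim: x => [|x IHx]; first by rewrite muln0 !addn0 subrr mulr0 addr0.
  have st : 'C(u + r * x.+1 + 1, j)%:R <= 'C(u + r * x + 1, j)%:R + r%:R * 'C(r * (u + x) + 1, j.-1)%:R :> R.
    rewrite -natrM -natrD ler_nat.
    rewrite (_ : (u + r * x.+1 + 1 = u + r * x + 1 + r)%N); last by rewrite mulnS; lia.
    case: (j) j0 => // j' _; apply: leq_trans (bin_addl_le _ _ _) _.
    rewrite leq_add2l leq_mul2l leq_bin2l ?orbT //= mulnDr.
    have := leq_mul (leqnn r.-1) u0; rewrite muln1 => h.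
    have : (r.-1 * u + u = r * u)%N by rewrite -mulSnr prednK // ltnW.
    move: r1 h u0; lia.
  have b : r%:R * 'C(r * (u + x) + 1, j.-1)%:R <= Y * ('C(u + x.+1, j)%:R - 'C(u + x, j)%:R) :> R.
    have -> : 'C(u + x.+1, j)%:R - 'C(u + x, j)%:R = 'C(u + x, j.-1)%:R :> R.
      by rewrite addnS; case: (j) j0 => // j' _; rewrite binS natrD addrAC subrr add0r.
    have jx : (j.-1 <= u + x)%N by lia.
    apply: (le_trans (ler_wpM2l _ (bin_mullS_le r1 jx))); first by rewrite ler0n.
    rewrite mulrA ler_wpM2r ?ler0n // /Y -[in leRHS](prednK j0) exprS.
    set y := (e * r%:R) ^+ j.-1.
    have y0 : 0 <= y by apply: exprn_ge0; lra.
    have : 0 <= r%:R * y by apply: mulr_ge0.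
    have -> : r%:R * (2 * y) = 2 * (r%:R * y) by ring.
    rewrite -mulrA => h; rewrite ler_wpM2r //.
  move: st b IHx; set a1 := (X in X <= _ + _); lra.
have uK : (u + (k - u) = k)%N by rewrite subnKC // ltnW.
have m1 : ('C(u, j) <= 'C(u + r * (k - u) + 1, j))%N by rewrite -addnA mono.
have m2 : ('C(u, j) <= 'C(k, j))%N by rewrite -uK mono.
have m3 : 'C(u + 1, j)%:R <= 'C(k, j)%:R :> R by rewrite ler_nat leq_bin2l // addn1.
have := ind (k - u)%N; rewrite uK !natrB //.
have : 0 <= (Y - 1) * ('C(k, j)%:R - 'C(u, j)%:R).
  by apply: mulr_ge0; rewrite subr_ge0 // ler_nat.
lra.
Qed.

End RealBounds.

Theorem theorem1p4 (R : realType) (n k r s : nat) (V : finType)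
    (H : {set {set V}}) :
  (0 < n)%N -> (0 < k)%N -> (0 < r)%N -> (0 < s)%N ->
  #|V| = n -> is_rgraph r H -> (matching_number H <= k)%N ->
  [/\ (r <= s <= k + r - 1)%N ->
      4 * (expR 1 * r%:R) ^+ (s - r + 2) * k%:R <= n%:R :> R ->
      (num_cliques r s H <= num_cliques r s (frankl n k r 1))%N,
      (k + r <= s <= (r - 1) * (k + 1))%N ->
      let a := ((s - r) %/ k + 1)%N in
      4 * r%:R ^+ 2 * k%:R * (expR 1 * r%:R / (a%:R - 1)) ^+ (s - r + a)
        <= n%:R :> R ->
      (num_cliques r s H <= num_cliques r s (frankl n k r a))%N
    & ((r - 1) * k + r <= s <= r * k + r - 1)%N ->
      (r * k + r - 1 <= n)%N ->
      (num_cliques r s H <= num_cliques r s (frankl n k r r))%N /\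
      ((num_cliques r s H < num_cliques r s (frankl n k r r))%N ->
       (num_cliques r s H <= 'C(r * k + r - 1, s) - 'C(r * k - 1, s - r))%N)].
Proof.
move=> n0 k0 r0 s0 cV Hr nuH.
have noM : ~ has_matching H k.+1.
  by move/(has_matching_number r0 Hr) => /leq_trans/(_ nuH); rewrite ltnn.
have top : ((r - 1) * k + r <= s <= r * k + r - 1)%N -> (r * k + r - 1 <= n)%N ->
      (num_cliques r s H <= num_cliques r s (frankl n k r r))%N /\
      ((num_cliques r s H < num_cliques r s (frankl n k r r))%N ->
       (num_cliques r s H <= 'C(r * k + r - 1, s) - 'C(r * k - 1, s - r))%N).
  case/andP=> ks _ Mn; rewrite num_cliques_frankl_top //; last first.
    by rewrite r0 (leq_trans (leq_addl _ _) ks).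
  case: (cliques_top cV r0 Hr noM ks Mn) => [->|le].
    by split; rewrite ?ltnn.
  by split=> //; apply: leq_trans le (leq_subr _ _).
have e2 := expR1_ge2 R; have e0 := expR_ge0 (1 : R).
have rR : (1 : R) <= r%:R by rewrite ler1n.
have kR : (1 : R) <= k%:R by rewrite ler1n.
have [H0 [H0r H0M H0c]] := transport_rgraph s cV Hr noM.
have [H1 [H1r H1M H1c H1s]] := exists_shifted s H0r H0M.
have le1 := leq_trans H0c H1c.
split=> // [/andP[rs sk] nb|/andP[ks sr] a nb].
  have er1 : 1 <= expR 1 * r%:R :> R.
    have : expR 1 * 1 <= expR 1 * r%:R :> R by rewrite ler_wpM2l.
    lra.
  (* For r = 1 the range of s lies in that of part (III), and both extremal graphs coincide. *)
  have [r1|r1] := leqP r 1.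
    have re : r = 1%N by lia.
    have kn : (k <= n)%N.
      rewrite -(ler_nat R); apply: le_trans nb; rewrite -[leLHS]mul1r ler_wpM2r ?ler0n //.
      have := @exprn_ege1 R (s - r + 2) _ er1; lra.
    by move: top; rewrite re => top; apply top; lia.
  apply: leq_trans le1 _; rewrite addn2 in nb.
  set y := (expR 1 * r%:R : R) in er1 nb.
  have j1 : (0 < s - r + 1 <= k)%N by lia.
  apply: cliques_bottom => //; first lia.
    rewrite -(ler_nat R); apply: le_trans nb; rewrite !natrM.
    rewrite ler_wpM2r ?ler0n //.
    (* From e >= 2, 4 y^2 >= 16 r^2, the size assumption of [cliques_bottom]. *)
    have h1 : 2 * r%:R <= y by rewrite ler_wpM2r ?ler0n.
    have h2 : (2 * r%:R) ^+ 2 <= y ^+ 2 by rewrite lerXn2r ?nnegrE //; lra.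
    have h3 : y ^+ 2 <= y ^+ (s - r).+2 by apply: ler_weXn2l.
    move: h2; rewrite exprMn [r%:R ^+ 2]expr2; lra.
  move=> u uk; rewrite -(ler_nat R) !natrM.
  have h := bin_diff_le R r1 uk j1; rewrite -/y in h.
  set P := (_ - _)%N%:R in h *; set Q := (_ - _)%N%:R in h *.
  have Q0 : 0 <= Q by rewrite /Q ler0n.
  have rk0 : 0 <= r%:R * k%:R :> R by rewrite mulr_ge0.
  apply: (@le_trans _ _ (4 * y ^+ (s - r).+2 * k%:R * Q)); last by rewrite ler_wpM2r.
  apply: (@le_trans _ _ (4 * (r%:R * k%:R) * (2 * y ^+ (s - r + 1) * Q))).
    by rewrite -[4 * r%:R * k%:R]mulrA ler_wpM2l // mulr_ge0.
  (* The exponent s - r + 2 is j + 1: beyond y^j from [bin_diff_le], one more factor y = e r absorbs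
     2 r. *)
  have -> : y ^+ (s - r).+2 = y * y ^+ (s - r + 1) by rewrite addn1 exprS.
  set z := y ^+ (s - r + 1) in h *.
  have z0 : 0 <= z by apply: exprn_ge0; lra.
  have w0 : 0 <= r%:R * k%:R * z * Q by rewrite !mulr_ge0.
  have : 0 <= (expR 1 - 2) * (r%:R * k%:R * z * Q).
    by apply: mulr_ge0 => //; rewrite subr_ge0.
  rewrite /y; lra.
apply: leq_trans le1 _.
have sdiv := divn_eq (s - r) k; have smod := ltn_pmod (s - r) k0.
pose d := ((s - r) %/ k)%N; rewrite -/d in sdiv.
have aE : a = d.+1 by rewrite /a addn1.
have d0 : (0 < d)%N by rewrite divn_gt0 //; lia.
have rk : (s - r < (r - 1) * k)%N.
  have : ((r - 1) * (k + 1) = (r - 1) * k + (r - 1))%N by rewrite mulnDr muln1.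
  lia.
have dr : (d < r - 1)%N.
  rewrite -(ltn_pmul2r k0); apply: leq_ltn_trans rk; rewrite sdiv; exact: leq_addr.
have dk : (d * k <= s - r)%N by rewrite sdiv leq_addr.
have ak : ((a - 1) * k <= s - r)%N by rewrite aE subn1.
have ska : (s - r < a * k)%N by rewrite aE mulSn sdiv; lia.
apply: cliques_middle => //; try by rewrite aE; lia.
  by apply: leq_trans ks; rewrite leq_addl.
rewrite -(ler_nat R); apply: le_trans nb; rewrite !natrM -expr2.
rewrite ler_wpM2l ?mulr_ge0 ?exprn_ge0 ?ler0n //.
(* The fraction is expanded by k + 1 because r k + r - 1 <= r (k + 1) and (a - 1) (k + 1) <= s - r +
   a. *)
have -> : expR 1 * r%:R / (a%:R - 1) = expR 1 * (r * k.+1)%N%:R / (d * k.+1)%N%:R :> R.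
  by rewrite aE -natr1 addrK !natrM mulrA -mulf_div divff ?mulr1 // pnatr_eq0.
apply: bin_le_ratio; rewrite ?muln_gt0 ?d0 //.
  by rewrite mulnS; lia.
by rewrite mulnS aE; lia.
Qed.
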